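(* Let $(\Phi_n,Y_n)_{n\ge0}$ be the AIR segment chain process (defined in the context) built from a family of Markov transition kernels $\{P_\gamma\}_{\gamma\in\Gamma}$ on $\chi$ with invariant distributions $\pi_\gamma$, satisfying the simultaneous minorisation condition $P^T_\gamma(x,\cdot)\ge\epsilon\,\nu(\cdot)$ for all $x\in\chi$, $\gamma\in\Gamma$. Let the adaptation lags satisfy $\frac1ck^\beta\le n_k\le ck^\beta$ for all $k\ge1$, for some $c\ge1$, $\beta>0$. Assume that $f:\chi\to\mathbb{R}$ is bounded and $\mathbb{E}_{\pi_\gamma}(f(X))=0$ for all $\gamma\in\Gamma$, and let $\widehat f^\Phi_n=\frac1n\sum_{i=0}^{n-1}F(\Phi_i)$. Then for every initial value $(\Phi_0,Y_0)\in\Omega\times\{0,1\}$, every $\gamma_0\in\Gamma$ and any adaptation scheme, if $\kappa<\min\left(\frac12,\frac{\beta}{1+\beta}\right)$ then $n^\kappa\widehat f^\Phi_n\to0$ almost surely as $n\to\infty$.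
   Context: **Underlying processes.** $\Gamma$ is a (metric) parameter space. For each $\gamma\in\Gamma$, $\{P^t_\gamma\}$ is the transition semigroup of a Markov process $\{X_t\}$ on $\chi$, in continuous time $t\ge0$ or in discrete time, with stationary distribution $\pi_\gamma$. There are $T>0$ (an integer in discrete time), $\epsilon\in(0,1)$ and a probability measure $\nu$ on $\chi$, all independent of $\gamma$, with $P^T_\gamma(x,\cdot)\ge\epsilon\nu(\cdot)$ for all $x\in\chi,\gamma\in\Gamma$. Usual measurability (measurable paths, jointly measurable densities) is assumed. **Segment chain.** $\Omega$ is the space of paths $\phi:[0,T]\to\chi$. In continuous time the segments of $X$ are $\Phi_n(t)=X_{nT+t}$; in discrete time $\Phi_n(t)=X_{nT+\lfloor t\rfloor}$, $t\in[0,T]$. $\mathbb{Q}_x(\cdot\,;\gamma)$ is the law on $\Omega$ of the path of $X$ on $[0,T]$ under parameter $\gamma$ with $X_0=x$, and $\mathbb{Q}_\mu=\int\mathbb{Q}_x\,\mu(\mathrm{d}x)$. **Split segment chain.** Put $\eta_\gamma(x,A)=\frac{P^T_\gamma(x,A)-\epsilon\nu(A)}{1-\epsilon}$, and let $\frac{\mathrm{d}\nu}{\mathrm{d}P^T_\gamma}(x,x')$, $\frac{\mathrm{d}\eta_\gamma}{\mathrm{d}P^T_\gamma}(x,x')$ be the densities at $x'$ of $\nu$ and $\eta_\gamma(x,\cdot)$ with respect to $P^T_\gamma(x,\cdot)$. The kernel $\check P_\gamma$ on $\check\Omega=\Omega\times\{0,1\}$ moves $(\phi,y)$ to $(\phi',y')$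 as follows: $\phi'$ has law with density $\frac{\mathrm{d}\nu}{\mathrm{d}P^T_\gamma}(\phi(T),\phi'(T))$ with respect to $\mathbb{Q}_{\phi(T)}(\mathrm{d}\phi';\gamma)$ if $y=1$, and density $\frac{\mathrm{d}\eta_\gamma}{\mathrm{d}P^T_\gamma}(\phi(T),\phi'(T))$ if $y=0$; then $y'\sim\mathrm{Bern}(\epsilon)$ independently of everything else. **AIR segment chain.** Lags $n_k\in\mathbb{N}$, $k\ge1$; $N_0=0$, $N_k=\sum_{i=1}^kn_i$. Given $(\Phi_0,Y_0)$ and $\gamma_0$, for $N_k\le n<N_{k+1}$ the chain $(\Phi_n,Y_n)$ evolves according to $\check P_{\gamma_k}$, and at time $N_{k+1}$ the parameter is updated to $\gamma_{k+1}$ by an arbitrary (possibly randomised) adaptation scheme based on the path $\Phi_0,\dots,\Phi_{N_{k+1}-1}$ so far and the previous parameters. **Function $F$.** For $\phi\in\Omega$, $F(\phi)=\frac1T\int_0^Tf(\phi(s))\,\mathrm{d}s$ in continuous time, and $F(\phi)=\frac1T\sum_{s=0}^{T-1}f(\phi(s))$ in discrete time. *)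

(* Defs.v *)
From HB Require Import structures.
From mathcomp Require Import all_boot all_order all_algebra.
From mathcomp Require Import all_classical all_reals all_analysis.

Set Implicit Arguments.
Unset Strict Implicit.
Unset Printing Implicit Defensive.
Import Order.TTheory GRing.Theory Num.Theory.
Import numFieldNormedType.Exports.

Local Open Scope classical_set_scope.
Local Open Scope ring_scope.
Local Open Scope ereal_scope.

(* Metric spaces with a distinguished point: the library requires every
   measurable type to be pointed. *)
#[short(type="pmetricType")]
HB.structure Definition PMetric (K : numDomainType) :=
  {M of Metric K M & Pointed M}.

Notation Borel G := (g_sigma_algebraType (@open G)).

(* The time index (real or integer) together with the segment length T. *)
Inductive clock (R : realType) := Continuous of R | Discrete of nat.
Arguments Continuous {R}.
Arguments Discrete {R}.

Section clock.
Context {R : realType}.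
Implicit Type c : clock R.

Definition horizon c : R :=
  match c with Continuous T => T | Discrete T => T%:R end.

Definition times c : set R :=
  match c with
  | Continuous _ => [set t | (0 <= t)%R]
  | Discrete _ => range (fun m : nat => m%:R)
  end.

(* A segment is indexed by real t in [0, T] in both cases; its value at t is
   the state of the process at time [tick c t] after the segment starts. *)
Definition tick c (t : R) : R :=
  match c with Continuous _ => t | Discrete _ => (Num.truncn t)%:R end.

End clock.

Section underlying_process.
Context {R : realType} {d : measure_display} {chi : measurableType d}.
Implicit Types (c : clock R) (p : R -> chi -> {measure set chi -> \bar R}).

Definition markov_semigroup c p :=
  (forall x A, measurable A -> p 0%R x A = \d_x A) /\
  (forall s t x A, times c s -> times c t -> measurable A ->
    p (s + t)%R x A = \int[p s x]_y p t y A).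

Definition stationary c p (mu : {measure set chi -> \bar R}) :=
  forall t A, times c t -> measurable A -> mu A = \int[mu]_x p t x A.

Definition is_density (mu : set chi -> \bar R)
    (lam : {measure set chi -> \bar R}) (g : chi -> R) :=
  [/\ measurable_fun setT g, forall x, (0 <= g x)%R &
      forall A, measurable A -> mu A = \int[lam]_(x in A) (g x)%:E].

(* The remainder kernel of the minorisation, as a set function. *)
Definition eta (PT : {measure set chi -> \bar R}) (eps : R)
    (nu : {measure set chi -> \bar R}) (A : set chi) : \bar R :=
  ((1 - eps)^-1)%:E * (PT A - eps%:E * nu A).

(* Probability that the segment of a process in state x at time s lies in A t
   at every t in ts, where ts is nondecreasing and starts at s or later. *)
Fixpoint fin_dim c p (A : R -> set chi) (s : R) (x : chi) (ts : seq R)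
    : \bar R :=
  if ts is t :: ts' then
    \int[p (tick c t - tick c s)%R x]_(y in A t) fin_dim c p A t y ts'
  else 1.

End underlying_process.

Section path_space.
Context {R : realType} {d dO : measure_display} {chi : measurableType d}
  {Omega : measurableType dO}.
Variables (c : clock R) (ev : R -> Omega -> chi).

(* Omega is a space of paths [0, T] -> chi, [ev t phi] standing for phi(t).
   Joint measurability of (t, phi) |-> phi(t) is what makes the time integral
   of f along phi a measurable function of phi; it is not needed when time is
   discrete. *)
Definition is_path_space :=
  [/\ forall phi psi : Omega,
        (forall t, (0 <= t <= horizon c)%R -> ev t phi = ev t psi) -> phi = psi,
      forall t, (0 <= t <= horizon c)%R -> measurable_fun setT (ev t) &
      match c with
      | Continuous T => measurable_fun (`[0%R, T]%classic `*` setT)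
                          (fun z : R * Omega => ev z.1 z.2)
      | Discrete _ => True
      end].

(* q x is the law of the segment over [0, T] of the Markov process with
   semigroup p started at x. *)
Definition is_path_law (p : R -> chi -> {measure set chi -> \bar R})
    (q : chi -> {measure set Omega -> \bar R}) :=
  forall (x : chi) (A : R -> set chi) (ts : seq R),
    (forall t, measurable (A t)) ->
    {in ts, forall t, (0 <= t <= horizon c)%R} -> sorted <=%R ts ->
    q x [set phi | forall t, t \in ts -> A t (ev t phi)]
    = fin_dim c p A 0%R x ts.

Definition segment_mean (f : chi -> R) (phi : Omega) : R :=
  match c with
  | Continuous T =>
      (T^-1 * \int[lebesgue_measure]_(s in `[0%R, T]) f (ev s phi))%R
  | Discrete T => (T%:R^-1 * \sum_(0 <= s < T) f (ev s%:R phi))%R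
  end.

(* Kernel of the split chain at fixed gamma: q is the segment law, dnu and
   deta the densities of nu and eta with respect to P^T. *)
Definition split_kernel (eps : R) (q : chi -> {measure set Omega -> \bar R})
    (dnu deta : chi -> chi -> R) (z : Omega * bool) (B : set (Omega * bool))
    : \bar R :=
  let x := ev (horizon c) z.1 in
  \int[q x]_phi
    (((if z.2 then dnu else deta) x (ev (horizon c) phi))%:E *
     bernoulli_prob eps [set y | B (phi, y)]).

End path_space.

(* The conditional law of X given the sigma-algebra F is K. *)
Definition cond_law {R : realType} {dS dE : measure_display}
    {S : measurableType dS} {E : measurableType dE} (Pr : probability S R)
    (F : set (set S)) (X : S -> E) (K : S -> set E -> \bar R) :=
  forall H B, F H -> measurable B ->
    Pr (H `&` X @^-1` B) = \int[Pr]_(w in H) K w B.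

(* N_k, with the lags indexed from 1. *)
Definition update_time (n : nat -> nat) (k : nat) : nat :=
  (\sum_(1 <= i < k.+1) n i)%N.

Section AIR.
Context {R : realType} {dS dO dG : measure_display} {S : measurableType dS}
  {Omega : measurableType dO} {G : measurableType dG}.
Variables (Pr : probability S R) (n : nat -> nat).
Variables (Phi : nat -> S -> Omega) (Y : nat -> S -> bool)
  (gam : nat -> S -> G).

(* sigma-algebra generated by Phi_0, Y_0, ..., Phi_m, Y_m and
   gamma_0, ..., gamma_k *)
Definition past (m k : nat) : set (set S) :=
  <<s [set H | exists i B, [/\ (i <= m)%N, measurable B &
                               H = (fun w => (Phi i w, Y i w)) @^-1` B]] `|`
      [set H | exists j B, [/\ (j <= k)%N, measurable B &
                               H = gam j @^-1` B]] >>.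

(* The (k+1)-st update draws gamma_{k+1} from the kernel [adapt k], evaluated
   at (Phi_0, ..., Phi_{N_{k+1} - 1}) and (gamma_0, ..., gamma_k); the draw may
   depend on nothing else of the past up to time N_{k+1}, in particular not on
   the Y's. *)
Record AIR_segment_chain
    (check : G -> Omega * bool -> set (Omega * bool) -> \bar R)
    (adapt : forall k : nat,
      R.-pker ((update_time n k.+1).-tuple Omega * k.+1.-tuple G) ~> G)
    (phi0 : Omega) (y0 : bool) (gam0 : G) : Prop := {
  AIR_measurable_Phi : forall m, measurable_fun setT (Phi m) ;
  AIR_measurable_Y : forall m, measurable_fun setT (Y m) ;
  AIR_measurable_gam : forall k, measurable_fun setT (gam k) ;
  AIR_init : forall w, [/\ Phi 0 w = phi0, Y 0 w = y0 & gam 0 w = gam0] ;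
  AIR_step : forall k m, (update_time n k <= m < update_time n k.+1)%N ->
    cond_law Pr (past m k) (fun w => (Phi m.+1 w, Y m.+1 w))
      (fun w => check (gam k w) (Phi m w, Y m w)) ;
  AIR_update : forall k,
    cond_law Pr (past (update_time n k.+1) k) (gam k.+1)
      (fun w => adapt k ([tuple Phi i w | i < update_time n k.+1],
                         [tuple gam j w | j < k.+1]))
}.

End AIR.

(* Main.v *)
From HB Require Import structures.
Require Import Defs.
From mathcomp Require Import all_boot all_order all_algebra.
From mathcomp Require Import all_classical all_reals all_analysis.
From mathcomp Require Import finmap measurable_realfun.
From mathcomp Require Import ring lra zify.
Import Order.TTheory GRing.Theory Num.Theory.
Import numFieldNormedType.Exports.
Set Implicit Arguments.
Unset Strict Implicit.
Unset Printing Implicit Defensive.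
Local Open Scope classical_set_scope.
Local Open Scope ring_scope.

(** Write h for the conditional mean of F over a segment, given its starting
    point. The minorisation makes the operator P^T - eps nu a contraction of
    ratio 1 - eps for the sup norm, so the sum u of its iterates on h is bounded
    uniformly in the parameter; integrating against pi kills eps nu(u), hence
    u = h + P^T u. Then g(phi, y) = E[F(phi') + u(phi'(T)) | phi, y] solves the
    Poisson equation of the split chain, and within an epoch
    F(Phi_{m+1}) + g(Z_{m+1}) - g(Z_m) is a bounded martingale increment.
    Exponential moments show that the martingale is O(sqrt m log m) almost
    surely. The coboundary telescopes within each epoch, so it contributes O(1)
    per epoch, that is O(m^(1/(1+beta))) in total, whatever the adaptation
    does. *)

(** * Monotone continuous functionals are integrals *)

Section ge0_functional.
Local Open Scope ereal_scope.
Context {R : realType}.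

(** Why [g] solves the Poisson equation: the next flag is Bernoulli(eps) and independent of the next
    path, and eps nu + (1 - eps) eta = P^T, so averaging [g] over the flag undoes the split and
    returns h + P^T u = u at the new endpoint. The parameter is random, so [u] and [g] are kept
    jointly measurable in (gamma, x); values at two parameters are never compared, and a change of
    parameter costs at most twice the bound of [g].

    The two entries of the minimum are the two error terms divided by m: the martingale gives 1/2 up
    to a logarithm, and beta/(1+beta) = 1 - 1/(1+beta) comes from the number of epochs.

    The technical obstacle is that kernels and conditional laws are specified on sets, while the
    argument integrates functions through several of them. Each such composition is treated as a
    functional on nonnegative functions and represented by one measure. Nonnegativity is why bounded
    functions carry a shift by their bound ([+ M], [+ B]). The martingale property enters the growth
    estimate only as orthogonality of an increment to exponentials of the preceding sum. *)

Record ge0_functional d (T : measurableType d) (L : (T -> \bar R) -> \bar R) :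
    Prop := {
  gf_ge0 : forall f : T -> \bar R, (forall x, 0 <= f x) -> 0 <= L f ;
  gf_add : forall f g : T -> \bar R, (forall x, 0 <= f x) -> (forall x, 0 <= g x) ->
    measurable_fun setT f -> measurable_fun setT g ->
    L (fun x => f x + g x) = L f + L g ;
  gf_scale : forall (r : R) (f : T -> \bar R), (0 <= r)%R -> (forall x, 0 <= f x) ->
    measurable_fun setT f -> L (fun x => r%:E * f x) = r%:E * L f ;
  gf_lim : forall (f_ : nat -> T -> \bar R) (f : T -> \bar R),
    (forall n x, 0 <= f_ n x) -> (forall n, measurable_fun setT (f_ n)) ->
    (forall x, {homo f_^~ x : m n / (m <= n)%N >-> m <= n}) ->
    (forall x, f_ ^~ x @ \oo --> f x) ->
    (fun n => L (f_ n)) @ \oo --> L f }.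

Section representation.
Context d (T : measurableType d) (L : (T -> \bar R) -> \bar R).
Hypothesis LP : ge0_functional L.

Let gf_zero : L (fun=> 0) = 0.
Proof.
have := gf_scale LP (lexx 0%R) (fun=> le_refl (0 : \bar R))
  (measurable_cst (0 : \bar R)).
by under eq_fun do rewrite mule0; rewrite mul0e.
Qed.

Let gf_sum (I : Type) (s : seq I) (f : I -> T -> \bar R) :
  (forall i x, 0 <= f i x) -> (forall i, measurable_fun setT (f i)) ->
  L (fun x => \sum_(i <- s) f i x) = \sum_(i <- s) L (f i).
Proof.
move=> f0 mf; elim: s => [|i s IH].
  by rewrite big_nil -[RHS]gf_zero; congr L; apply/funext => x; rewrite big_nil.
rewrite big_cons -IH -gf_add//.
- by congr L; apply/funext => x; rewrite big_cons.
- by move=> x; apply: sume_ge0.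
- exact: emeasurable_sum.
Qed.

Let mu (A : set T) := L (fun x => \d_x A).

Let mindic (A : set T) : measurable A -> measurable_fun setT (fun x => \d_x A : \bar R).
Proof.
move=> mA; rewrite (_ : (fun x => _) = EFin \o \1_A)//.
exact/measurable_EFinP/measurable_indic.
Qed.

Let mu0 : mu set0 = 0.
Proof.
by rewrite /mu -[RHS]gf_zero; congr L; apply/funext => x; rewrite measure0.
Qed.

Let mu_ge0 A : 0 <= mu A. Proof. exact: gf_ge0. Qed.

Let mu_sigma_additive : semi_sigma_additive mu.
Proof.
move=> U mU tU mUU; rewrite /mu.
rewrite [X in X @ _ --> _](_ : _ =
    (fun n => L (fun x => \sum_(0 <= i < n) \d_x (U i)))).
  apply: gf_lim => //.
  - by move=> n x; apply: sume_ge0.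
  - by move=> n; apply: emeasurable_sum => i; exact: mindic.
  - by move=> x m n mn; exact: lee_sum_nneg_natr.
  - by move=> x; exact: measure_semi_sigma_additive.
by apply/funext => n; rewrite gf_sum// => i; exact: mindic.
Qed.

HB.instance Definition _ := isMeasure.Build _ _ _ mu mu0 mu_ge0
  mu_sigma_additive.

Import HBNNSimple.

Let mu_integral (f : T -> \bar R) : (forall x, 0 <= f x) ->
  measurable_fun setT f -> L f = \int[mu]_x f x.
Proof.
move=> f0 mf; pose f_ := nnsfun_approx measurableT mf.
have H1 : (fun n => L (EFin \o f_ n)) @ \oo --> L f.
  apply: gf_lim => //.
  - by move=> n x; rewrite lee_fin.
  - by move=> n; exact/measurable_EFinP.
  - by move=> x m n mn; rewrite lee_fin; exact/lefP/nd_nnsfun_approx.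
  - by move=> x; exact: cvg_nnsfun_approx.
have H2 : (fun n => \int[mu]_x (EFin \o f_ n) x) @ \oo --> \int[mu]_x f x.
  have := @cvg_monotone_convergence _ _ _ mu setT measurableT
    (fun n => EFin \o f_ n).
  rewrite (_ : (fun x => limn _) = f).
    apply.
    - by move=> n; exact/measurable_EFinP.
    - by move=> n x _; rewrite lee_fin.
    - by move=> x _ m n mn; rewrite lee_fin; exact/lefP/nd_nnsfun_approx.
  by apply/funext => x; apply/cvg_lim => //; exact: cvg_nnsfun_approx.
suff E : (fun n => L (EFin \o f_ n)) = (fun n => \int[mu]_x (EFin \o f_ n) x).
  by rewrite E in H1; exact: (cvg_unique _ H1 H2).
apply/funext => n; rewrite integralT_nnsfun sintegralE.
rewrite fsbig_finite/=; last exact: fimfunP.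
(* [gf_sum] wants every summand nonnegative, whatever the index. Replacing [r] by its absolute value
   achieves this and changes nothing, since a negative [r] has empty preimage. *)
transitivity (L (fun x => \sum_(r <- fset_set (range (f_ n)))
    `|r|%:E * \d_x (f_ n @^-1` [set r]))).
  congr L; apply/funext => x /=; rewrite fimfunE fsbig_finite//= -sumEFin.
  apply: eq_bigr => r _; rewrite diracE EFinM; have [r0|r0] := leP 0%R r.
    by rewrite ger0_norm.
  by rewrite preimage_nnfun0// !indic0 in_set0/= !mule0.
rewrite gf_sum; last 2 first.
- by move=> r x; rewrite mule_ge0// lee_fin.
- by move=> r; apply: measurable_funeM; exact/mindic/measurable_sfunP.
apply: eq_bigr => r _; rewrite gf_scale//; last exact/mindic/measurable_sfunP.
have [r0|r0] := leP 0%R r; first by rewrite ger0_norm.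
by rewrite preimage_nnfun0// -/(mu set0) measure0 !mule0.
Qed.

(** A Daniell-type representation: finite additivity and scaling settle simple functions, monotone
    limits do the rest. An identity between iterated integrals can then be checked on indicators. *)
Lemma gf_measure : exists m : {measure set T -> \bar R},
  forall f, (forall x, 0 <= f x) -> measurable_fun setT f ->
    L f = \int[m]_x f x.
Proof. by exists mu => f f0 mf; exact: mu_integral. Qed.

End representation.

Lemma gf_probability d (T : measurableType d) (L : (T -> \bar R) -> \bar R) :
  ge0_functional L -> L (fun=> 1) = 1 ->
  exists m : probability T R,
  forall f, (forall x, 0 <= f x) -> measurable_fun setT f ->
    L f = \int[m]_x f x.
Proof.
move=> LP L1; have [m mL] := gf_measure LP.
have m1 : m setT = 1.
  by rewrite -[RHS]L1 mL// integral_cst// mul1e.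
(* The mass is already 1; normalising only packages [m] as a probability, and the Dirac default is
   never reached. *)
exists (mnormalize m \d_(point : T)) => f f0 mf; rewrite mL//.
apply: eq_measure_integral => A mA _.
by rewrite /= /mnormalize m1 onee_eq0/= invr1 mule1.
Qed.

Lemma gf_eval d (T : measurableType d) (x : T) :
  ge0_functional (fun f : T -> \bar R => f x).
Proof. by split => // f_ f f0 mf ndf fl; exact: fl. Qed.

Lemma gf_mul d (T : measurableType d) (r : R) (L : (T -> \bar R) -> \bar R) :
  (0 <= r)%R -> ge0_functional L -> ge0_functional (fun f => r%:E * L f).
Proof.
move=> r0 LP; split.
- by move=> f f0; rewrite mule_ge0// ?lee_fin//; exact: gf_ge0.
- by move=> f g f0 g0 mf mg; rewrite gf_add// ge0_muleDr//; exact: gf_ge0.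
- by move=> a f a0 f0 mf; rewrite gf_scale// !muleA (muleC r%:E).
- by move=> f_ f f0 mf ndf fl; apply: cvgeZl => //; exact: (gf_lim LP).
Qed.

Lemma gf_plus d (T : measurableType d) (L1 L2 : (T -> \bar R) -> \bar R) :
  ge0_functional L1 -> ge0_functional L2 ->
  ge0_functional (fun f => L1 f + L2 f).
Proof.
move=> P1 P2; split.
- by move=> f f0; rewrite adde_ge0//; [exact: (gf_ge0 P1)|exact: (gf_ge0 P2)].
- by move=> f g f0 g0 mf mg; rewrite (gf_add P1)// (gf_add P2)// addeACA.
- move=> a f a0 f0 mf; rewrite (gf_scale P1)// (gf_scale P2)// ge0_muleDr//.
  + exact: (gf_ge0 P1).
  + exact: (gf_ge0 P2).
- move=> f_ f f0 mf ndf fl; apply: cvgeD; last 2 first.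
  + exact: (gf_lim P1).
  + exact: (gf_lim P2).
  apply: ge0_adde_def; rewrite inE.
  + by apply: (gf_ge0 P1) => x; apply: (cvge_ge _ (fl x)); near do exact: f0.
  + by apply: (gf_ge0 P2) => x; apply: (cvge_ge _ (fl x)); near do exact: f0.
Unshelve. all: by end_near. Qed.

Lemma gf_le d (T : measurableType d) (L : (T -> \bar R) -> \bar R) f g :
  ge0_functional L -> (forall x, 0 <= f x) ->
  measurable_fun setT f -> measurable_fun setT g ->
  (forall x, f x <= g x) -> L f <= L g.
Proof.
move=> LP f0 mf mg fg; have [m mL] := gf_measure LP.
by rewrite !mL//; [exact: ge0_le_integral|move=> x; exact: le_trans (fg x)].
Qed.

(** Together with [gf_eval], this closure under mixing makes every iterated kernel integral a
    functional, so that composed kernels come from [gf_measure] instead of a construction. *)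
Lemma gf_integral d (T : measurableType d) d' (X : measurableType d')
    (m : {measure set X -> \bar R}) (L : X -> (T -> \bar R) -> \bar R) :
  (forall x, ge0_functional (L x)) ->
  (forall f, (forall z, 0 <= f z) -> measurable_fun setT f ->
    measurable_fun setT (L ^~ f)) ->
  ge0_functional (fun f => \int[m]_x L x f).
Proof.
move=> LP mL; split.
- by move=> f f0; apply: integral_ge0 => x _; exact: (gf_ge0 (LP x)).
- move=> f g f0 g0 mf mg; rewrite -ge0_integralD//.
  + by apply: eq_integral => x _; rewrite (gf_add (LP x)).
  + by move=> x _; exact: (gf_ge0 (LP x)).
  + exact: mL.
  + by move=> x _; exact: (gf_ge0 (LP x)).
  + exact: mL.
- move=> a f a0 f0 mf; rewrite -ge0_integralZl_EFin//.
  + by apply: eq_integral => x _; rewrite (gf_scale (LP x)).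
  + by move=> x _; exact: (gf_ge0 (LP x)).
  + exact: mL.
- move=> f_ f f0 mf ndf fl.
  rewrite (_ : \int[m]_x L x f = \int[m]_x (limn (fun n => L x (f_ n)))).
    apply: cvg_monotone_convergence => //.
    + by move=> n; exact: mL.
    + by move=> n x _; exact: (gf_ge0 (LP x)).
    + by move=> x _ i j ij; apply: (gf_le (LP x)) => // z; exact: ndf.
  by apply: eq_integral => x _; apply/esym/cvg_lim => //; exact: (gf_lim (LP x)).
Qed.

End ge0_functional.

(** * Integrating against a conditional law *)

Section cond_law_functional.
Local Open Scope ereal_scope.
Context {R : realType} {dS dE : measure_display} {S : measurableType dS}
  {E : measurableType dE}.
Variables (Pr : probability S R) (F : set (set S)).
Hypothesis F_sub : <<s F >> `<=` @measurable _ S.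
Local Notation S' := (g_sigma_algebraType F).

Lemma measurable_fun_coarser d' (U : measurableType d') (h : S -> U) :
  measurable_fun (setT : set S') h -> measurable_fun (setT : set S) h.
Proof. by move=> mh _ A mA; apply: F_sub; exact: mh. Qed.

(** [cond_law] is the case where [J] is the indicator of a rectangle H x B. Both sides are
    functionals of [J] of mass 1, hence probabilities on [S' * E], and rectangles form a generating
    pi-system. Taking the coarse sigma-algebra [S'] on the first factor lets [J] depend on the past
    and on nothing later except [X]. *)
Lemma cond_law_integral (X : S -> E) (K : S -> (E -> \bar R) -> \bar R) :
  measurable_fun setT X ->
  (forall w, ge0_functional (K w)) -> (forall w, K w (fun=> 1) = 1) ->
  (forall J : S' * E -> \bar R, (forall z, 0 <= J z) -> measurable_fun setT J ->
     measurable_fun (setT : set S') (fun w => K w (fun z => J (w, z)))) ->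
  cond_law Pr <<s F >> X (fun w B => K w (fun z => \d_z B)) ->
  forall J : S' * E -> \bar R, (forall z, 0 <= J z) -> measurable_fun setT J ->
  \int[Pr]_w J (w, X w) = \int[Pr]_w K w (fun z => J (w, z)).
Proof.
move=> mX KP K1 mK XK J J0 mJ.
have mG : measurable_fun (setT : set S) (fun w => (w, X w) : S' * E).
  apply: measurable_fun_pair => //.
  by move=> _ A mA; rewrite setTI; exact: F_sub.
have msec (J' : S' * E -> \bar R) w : measurable_fun setT J' ->
    measurable_fun setT (fun z => J' (w, z)).
  by move=> mJ'; apply: measurableT_comp => //; exact: measurable_pair1.
pose L1 (J' : S' * E -> \bar R) := \int[Pr]_w J' (w, X w).
pose L2 (J' : S' * E -> \bar R) := \int[Pr]_w K w (fun z => J' (w, z)).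
have L1P : ge0_functional L1.
  apply: gf_integral => [w|J' J'0 mJ']; first exact: gf_eval.
  exact: measurableT_comp mJ' mG.
have L2P : ge0_functional L2.
  apply: gf_integral => [w|J' J'0 mJ'].
    split.
    - by move=> f f0; exact: (gf_ge0 (KP w)).
    - by move=> f g f0 g0 mf mg; apply: (gf_add (KP w)) => //; exact: msec.
    - by move=> r f r0 f0 mf; apply: (gf_scale (KP w)) => //; exact: msec.
    - by move=> f_ f f0 mf ndf fl; apply: (gf_lim (KP w)) => // n; exact: msec.
  by apply: measurable_fun_coarser; exact: mK.
have L11 : L1 (fun=> 1) = 1.
  by rewrite /L1 integral_cst// mul1e; exact: probability_setT.
have L21 : L2 (fun=> 1) = 1.
  rewrite /L2; under eq_integral do rewrite K1.
  by rewrite integral_cst// mul1e; exact: probability_setT.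
have [m1 m1E] := gf_probability L1P L11.
have [m2 m2E] := gf_probability L2P L21.
rewrite -[LHS]/(L1 J) -[RHS]/(L2 J) m1E// m2E//.
apply: eq_measure_integral => A mA _.
pose G := [set A : set (S' * E) | exists H B,
  [/\ measurable H, measurable B & A = H `*` B]].
apply: (measure_unique G (fun=> setT)) => //.
- rewrite measurable_prod_measurableType; congr (<<s _ >>).
  rewrite predeqE => Z; split => [[H mH [B mB <-]]|[H [B [mH mB ->]]]].
    by exists H, B.
  by exists H => //; exists B.
- move=> _ _ [H [B [mH mB ->]]] [H' [B' [mH' mB' ->]]].
  exists (H `&` H'), (B `&` B'); rewrite -setXI; split => //.
  + exact: measurableI.
  + exact: measurableI.
- by move=> _; exists setT, setT; rewrite setXTT; split.
- by rewrite bigcup_const.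
- move=> _ [H [B [mH mB ->]]].
  have mHB : measurable (H `*` B) by exact: measurableX.
  have mI : measurable_fun setT (fun z : S' * E => (\1_(H `*` B) z)%:E : \bar R).
    by apply/measurable_EFinP; exact: measurable_indic.
  transitivity (L1 (fun z => (\1_(H `*` B) z)%:E)).
    by rewrite m1E// ?integral_indic// ?setIT// => z; rewrite lee_fin.
  transitivity (L2 (fun z => (\1_(H `*` B) z)%:E)); last first.
    by rewrite m2E// ?integral_indic// ?setIT// => z; rewrite lee_fin.
  transitivity (Pr (H `&` X @^-1` B)).
    rewrite -(setIT (H `&` _)) -integral_indic//.
    by apply: measurableI; [exact: F_sub|rewrite -[X in measurable X]setTI; exact: mX].
  rewrite XK// /L2 [LHS]integral_mkcond; apply: eq_integral => w _.
  rewrite patchE; case: ifPn => wH.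
    by congr (K w _); apply/funext => z; rewrite diracE indicE in_setX wH.
  transitivity (K w (fun=> 0)).
    have := gf_scale (KP w) (lexx 0%R) (fun=> le_refl (0 : \bar R))
      (measurable_cst (0 : \bar R)).
    by under eq_fun do rewrite mule0; rewrite mul0e.
  by congr (K w _); apply/funext => z; rewrite indicE in_setX (negbTE wH).
- by move=> _; rewrite -ge0_fin_numE// fin_num_measure.
Qed.

End cond_law_functional.

(** * The Poisson equation of the segment endpoints *)

Section bounded_integration.
Context {R : realType}.

Section one_measure.
Context {d} {T : measurableType d} (m : {measure set T -> \bar R}).
Hypothesis m1 : m setT = 1%E.

Lemma integrable_bounded (f : T -> R) (B : R) : measurable_fun setT f ->
  (forall x, `|f x| <= B) -> m.-integrable setT (EFin \o f).
Proof.
move=> mf fB; apply: measurable_bounded_integrable => //.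
  by rewrite m1 ltry.
exists B; split; first exact: num_real.
by move=> y By x _ /=; rewrite (le_trans (fB x))// ltW.
Qed.

Lemma Rintegral_const (r : R) : \int[m]_x r = r.
Proof. by rewrite Rintegral_cst// m1 mulr1. Qed.

(** The bridge between real integrals of bounded signed functions and extended integrals of
    nonnegative ones: mass 1 makes the shift come out as exactly [B]. *)
Lemma Rintegral_shift (f : T -> R) (B : R) : measurable_fun setT f ->
  (forall x, `|f x| <= B) ->
  (\int[m]_x (f x + B)%:E = (\int[m]_x f x + B)%:E)%E.
Proof.
move=> mf fB; have If := integrable_bounded mf fB.
have IB : m.-integrable setT (EFin \o cst B).
  by apply: (@integrable_bounded _ `|B|).
rewrite -[in RHS](Rintegral_const B) -RintegralD//.
rewrite fineK//; apply: integrable_fin_num => //.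
by apply: (@integrable_bounded (fun x => f x + B) (B + `|B|)) => [|x];
  [exact: measurable_funD|rewrite (le_trans (ler_normD _ _))// lerD].
Qed.

Lemma le_Rintegral_bounded (f g : T -> R) (A B : R) :
  measurable_fun setT f -> (forall x, `|f x| <= A) ->
  measurable_fun setT g -> (forall x, `|g x| <= B) ->
  (forall x, f x <= g x) -> \int[m]_x f x <= \int[m]_x g x.
Proof.
move=> mf fA mg gB fg; apply: le_Rintegral => //.
- exact: integrable_bounded mf fA.
- exact: integrable_bounded mg gB.
Qed.

Lemma Rintegral_bounded (f : T -> R) (B : R) : measurable_fun setT f ->
  (forall x, `|f x| <= B) -> `|\int[m]_x f x| <= B.
Proof.
move=> mf fB; rewrite ler_norml -[X in - X]Rintegral_const.
rewrite -mulN1r -RintegralZl//; last first.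
  by apply: (@integrable_bounded _ `|B|).
rewrite -[X in _ && (_ <= X)]Rintegral_const.
have B0 (x : T) : 0 <= B by exact: le_trans (normr_ge0 _) (fB x).
apply/andP; split; apply: (@le_Rintegral_bounded _ _ B B) => // x.
- by rewrite mulN1r normrN ger0_norm// (B0 x).
- by rewrite mulN1r; have := fB x; rewrite ler_norml => /andP[].
- by rewrite ger0_norm// (B0 x).
- by rewrite (le_trans (ler_norm _)).
Qed.

Lemma Rintegral_cvg (f_ : nat -> T -> R) (f : T -> R) (B : R) :
  (forall n, measurable_fun setT (f_ n)) -> (forall n x, `|f_ n x| <= B) ->
  (forall x, f_ ^~ x @ \oo --> f x) ->
  (fun n => \int[m]_x f_ n x) @ \oo --> \int[m]_x f x.
Proof.
move=> mf fB fl.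
have mlim : measurable_fun setT f by apply: measurable_fun_cvg (fun x _ => fl x).
have limB (x : T) : `|f x| <= B.
  by apply: (cvgr_to_le (cvg_norm (fl x))); near do exact: fB.
have IB : m.-integrable setT (EFin \o cst B).
  by apply: (@integrable_bounded _ `|B|).
have [|||||_ _ cv] := @dominated_convergence _ _ _ m setT measurableT
    (fun n => EFin \o f_ n) (EFin \o f) (EFin \o cst B).
- by move=> n; exact/measurable_EFinP.
- exact/measurable_EFinP.
- by apply: aeW => x _; apply: cvg_EFin; [exact: nearW|exact: fl].
- exact: IB.
- by apply: aeW => x n _; rewrite /= lee_fin.
rewrite /Rintegral; apply: fine_cvg; rewrite fineK//.
by apply: integrable_fin_num => //; exact: integrable_bounded mlim limB.
Unshelve. all: by end_near. Qed.

End one_measure.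

Lemma measurable_Rintegral_kernel d d' (X : measurableType d)
    (Y : measurableType d') (k : R.-pker X ~> Y) (f : X * Y -> R) (B : R) :
  measurable_fun setT f -> (forall z, `|f z| <= B) ->
  measurable_fun setT (fun x => \int[k x]_y f (x, y)).
Proof.
move=> mf fB.
have msec x : measurable_fun setT (fun y => f (x, y)).
  by apply: measurableT_comp => //; exact: measurable_pair1.
rewrite (_ : (fun x => _) =
    (fun x => fine (\int[k x]_y (f (x, y) + B)%:E)%E - B)).
  apply: measurable_funB => //; apply: measurableT_comp => //.
  apply: (measurable_fun_integral_finite_kernel (fun z => (f z + B)%:E) k).
    move=> z; rewrite lee_fin -lerBlDr sub0r.
    by have := fB z; rewrite ler_norml => /andP[].
  by apply/measurable_EFinP; exact: measurable_funD.
apply/funext => x; rewrite (Rintegral_shift _ (msec x))//=; last exact: prob_kernel.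
by rewrite addrK.
Qed.

End bounded_integration.

Section poisson_equation.
Context {R : realType} {dG d : measure_display} {G : measurableType dG}
  {chi : measurableType d}.
Variables (PT : R.-pker (G * chi) ~> chi) (nu : probability chi R) (eps : R)
  (pi_ : G -> probability chi R) (h : G * chi -> R) (M : R).
Hypotheses (eps01 : 0 < eps < 1)
  (minor : forall z A, measurable A -> (eps%:E * nu A <= PT z A)%E)
  (stat : forall g A, measurable A -> (pi_ g A = \int[pi_ g]_x PT (g, x) A)%E)
  (mh : measurable_fun setT h) (hM : forall z, `|h z| <= M)
  (h_centred : forall g, \int[pi_ g]_x h (g, x) = 0).

Let PT1 z : PT z setT = 1%E. Proof. exact: prob_kernel. Qed.
Let nu1 : nu setT = 1%E. Proof. exact: probability_setT. Qed.
Let pi1 g : pi_ g setT = 1%E. Proof. exact: probability_setT. Qed.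

Let msec (w : G * chi -> R) g : measurable_fun setT w ->
  measurable_fun setT (fun y => w (g, y)).
Proof. by move=> mw; apply: measurableT_comp => //; exact: measurable_pair1. Qed.

(** This is [1 - eps] times the operator of the remainder kernel eta, with the parameter frozen. *)
Definition residual_op (w : G * chi -> R) (z : G * chi) : R :=
  \int[PT z]_y w (z.1, y) - eps * \int[nu]_y w (z.1, y).

Lemma measurable_residual_op (w : G * chi -> R) (B : R) : measurable_fun setT w ->
  (forall z, `|w z| <= B) -> measurable_fun setT (residual_op w).
Proof.
move=> mw wB; apply: measurable_funB.
  apply: (@measurable_Rintegral_kernel _ _ _ _ _ PT (fun z => w (z.1.1, z.2)) B).
    apply: measurableT_comp => //; apply: measurable_fun_pair => //.
    exact: measurableT_comp.
  by move=> z.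
apply: measurable_funM => //.
pose k : R.-pker (G * chi) ~> chi := kprobability (measurable_cst (nu : pprobability chi R)).
apply: (@measurable_Rintegral_kernel _ _ _ _ _ k (fun z => w (z.1.1, z.2)) B).
  apply: measurableT_comp => //; apply: measurable_fun_pair => //.
  exact: measurableT_comp.
by move=> z.
Qed.

(** The minorisation applies to the nonnegative function [v + B] and gives eps (nu v + B) <= P^T v +
    B. Taking [v = w] yields the lower bound, [v = - w] the upper one. *)
Lemma residual_op_le (w : G * chi -> R) (B : R) : measurable_fun setT w ->
  (forall z, `|w z| <= B) ->
  forall z, `|residual_op w z| <= (1 - eps) * B.
Proof.
move=> mw wB z.
have eps0 : 0 <= eps by rewrite ltW//; case/andP: eps01.
have key (v : chi -> R) : measurable_fun setT v -> (forall x, `|v x| <= B) ->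
    eps * (\int[nu]_y v y + B) <= \int[PT z]_y v y + B.
  move=> mv vB; rewrite -lee_fin EFinM -!Rintegral_shift//.
  have v0 x : (0 <= (v x + B)%:E)%E.
    rewrite lee_fin -lerBlDr sub0r.
    by have := vB x; rewrite ler_norml => /andP[].
  have mvB : measurable_fun setT (fun x => (v x + B)%:E).
    by apply/measurable_EFinP; exact: measurable_funD.
  rewrite -(ge0_integral_mscale _ _ (NngNum eps0))//.
  by apply: ge0_le_measure_integral => // A mA; exact: minor.
have mwz := msec z.1 mw.
rewrite /residual_op ler_norml; apply/andP; split.
  by have := key _ mwz (fun x => wB _); lra.
have mN : measurable_fun setT (fun y => -1 * w (z.1, y)).
  by apply: measurable_funM => //.
have NB x : `|-1 * w (z.1, x)| <= B by rewrite mulN1r normrN.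
have := key _ mN NB; rewrite !RintegralZl//.
- by lra.
- exact: (integrable_bounded (PT1 z) mwz (fun x => wB _)).
- exact: (integrable_bounded nu1 mwz (fun x => wB _)).
Qed.

Let h_ (j : nat) : G * chi -> R := iter j residual_op h.

Let mh_hM j : measurable_fun setT (h_ j) /\
  forall z, `|h_ j z| <= M * (1 - eps) ^+ j.
Proof.
elim: j => [|j [mhj hjM]]; first by split => // z; rewrite expr0 mulr1.
split; first exact: measurable_residual_op mhj hjM.
by move=> z; rewrite exprS mulrCA; exact: residual_op_le.
Qed.

Let M_ge0 : 0 <= M.
Proof. exact: le_trans (normr_ge0 _) (hM point). Qed.

Let s_ (N : nat) (z : G * chi) : R := series (h_ ^~ z) N.

Let q_lt1 : `|1 - eps| < 1.
Proof. by case/andP: eps01 => e0 e1; rewrite ger0_norm; lra. Qed.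

Let s_cvg z : cvgn (s_ ^~ z).
Proof.
apply: (@normed_cvg _ R (h_ ^~ z)).
apply: (@series_le_cvg _ _ (geometric M (1 - eps))) => //.
- by move=> j; exact: normr_ge0.
- by move=> j; apply: (@geometric_ge0 _ M) => //; case/andP: eps01; lra.
- by move=> j; have [_] := mh_hM j; exact.
- exact: is_cvg_geometric_series.
Qed.

(** The geometric series with first term [M] and ratio [1 - eps] has sum [M / eps], whatever the
    parameter. *)
Let s_bound N z : `|s_ N z| <= M / eps.
Proof.
rewrite /s_ /series/= (le_trans (ler_norm_sum _ _ _))//.
apply: (@le_trans _ _ (series (geometric M (1 - eps)) N)).
  by apply: ler_sum => j _; have [_] := mh_hM j; exact.
have := @geometric_le_lim _ N M (1 - eps) M_ge0.
by rewrite subKr; apply => //; case/andP: eps01; lra.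
Qed.

Let ms_ N : measurable_fun setT (s_ N).
Proof.
rewrite /s_ /series/=; apply: measurable_sum => j.
by have [] := mh_hM j.
Qed.

Let u (z : G * chi) : R := limn (s_ ^~ z).

Let mu : measurable_fun setT u.
Proof. by apply: (measurable_fun_cvg ms_) => z _; exact: s_cvg. Qed.

Let uM z : `|u z| <= M / eps.
Proof.
have /cvg_norm/cvgr_to_le : s_ ^~ z @ \oo --> u z by exact: s_cvg.
by apply; near do exact: s_bound.
Unshelve. all: by end_near. Qed.

Let residual_sum N z : residual_op (s_ N) z = s_ N.+1 z - h z.
Proof.
elim: N => [|N IH].
  have s0 z' : s_ 0 z' = 0 by rewrite /s_ /series/= big_geq.
  rewrite [in RHS]/s_ /series/= big_nat1 subrr /residual_op.
  under eq_Rintegral do rewrite s0.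
  under [X in _ - _ * X]eq_Rintegral do rewrite s0.
  by rewrite !Rintegral_const// mulr0 subrr.
have E N' z' : s_ N'.+1 z' = s_ N' z' + h_ N' z'.
  by rewrite /s_ /series/= big_nat_recr.
have [mhN hN] := mh_hM N.
rewrite [in RHS]E addrAC -IH /residual_op.
under eq_Rintegral do rewrite E.
under [X in _ - _ * X]eq_Rintegral do rewrite E.
rewrite !RintegralD//; last 4 first.
- exact: (integrable_bounded _ (msec _ (ms_ N)) (fun x => s_bound _ _)).
- exact: (integrable_bounded _ (msec _ mhN) (fun x => hN _)).
- exact: (integrable_bounded _ (msec _ (ms_ N)) (fun x => s_bound _ _)).
- exact: (integrable_bounded _ (msec _ mhN) (fun x => hN _)).
by rewrite [h_ N.+1 z]/h_ iterS -/(h_ N) /residual_op; ring.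
Qed.

Let residual_u z : residual_op u z = u z - h z.
Proof.
have H1 : (fun N => residual_op (s_ N) z) @ \oo --> residual_op u z.
  apply: cvgB; last apply: cvgMr.
  - apply: (Rintegral_cvg (PT1 z) (fun N => msec _ (ms_ N))
      (fun N y => s_bound N (z.1, y))) => y; exact: s_cvg.
  - apply: (Rintegral_cvg nu1 (fun N => msec _ (ms_ N))
      (fun N y => s_bound N (z.1, y))) => y; exact: s_cvg.
have H2 : (fun N => residual_op (s_ N) z) @ \oo --> u z - h z.
  under eq_fun do rewrite residual_sum.
  by apply: cvgB; [rewrite cvg_shiftS; exact: s_cvg|exact: cvg_cst].
exact: (cvg_unique _ H1 H2).
Qed.

(** Stationarity is given on sets. The composition of [pi_ g] with P^T is one measure by
    [gf_measure], and it agrees with [pi_ g] on sets, hence on functions. *)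
Let stat_Rintegral (w : G * chi -> R) (B : R) g : measurable_fun setT w ->
  (forall z, `|w z| <= B) ->
  \int[pi_ g]_x \int[PT (g, x)]_y w (g, y) = \int[pi_ g]_x w (g, x).
Proof.
move=> mw wB.
have mI : measurable_fun setT (fun x => \int[PT (g, x)]_y w (g, y)).
  apply: (measurableT_comp (f := fun z => \int[PT z]_y w (z.1, y))) => //.
  apply: (@measurable_Rintegral_kernel _ _ _ _ _ PT (fun z => w (z.1.1, z.2)) B).
    apply: measurableT_comp => //; apply: measurable_fun_pair => //.
    exact: measurableT_comp.
  by move=> z.
have IB x : `|\int[PT (g, x)]_y w (g, y)| <= B.
  by apply: Rintegral_bounded => //; exact: msec.
apply: (@addIr _ B); apply: EFin_inj.
rewrite -(Rintegral_shift (pi1 g) mI IB).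
rewrite -(Rintegral_shift (pi1 g) (msec g mw) (fun x => wB _)).
under eq_integral.
  move=> x _; rewrite -(Rintegral_shift (PT1 _) (msec g mw) (fun x => wB _)).
  over.
pose L (f : chi -> \bar R) := (\int[pi_ g]_x \int[PT (g, x)]_y f y)%E.
have LP : ge0_functional L.
  apply: gf_integral => [x|f f0 mf].
    by apply: gf_integral => [y|f f0 mf] //; exact: gf_eval.
  apply: (measurableT_comp (f := fun z => \int[PT z]_y f y)%E) => //.
  by apply: measurable_fun_integral_kernel => // U mU; exact: measurable_kernel.
have [m mL] := gf_measure LP.
have w0 x : (0 <= (w (g, x) + B)%:E)%E.
  rewrite lee_fin -lerBlDr sub0r.
  by have := wB (g, x); rewrite ler_norml => /andP[].
have mwB : measurable_fun setT (fun x => (w (g, x) + B)%:E).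
  by apply/measurable_EFinP; apply: measurable_funD => //; exact: msec.
rewrite -[LHS]/(L (fun y => (w (g, y) + B)%:E)) mL//.
apply: eq_measure_integral => A mA _.
rewrite [RHS]stat// -(setIT A) -integral_indic// -mL//; last first.
  by apply/measurable_EFinP; exact: measurable_indic.
apply: eq_integral => x _; rewrite integral_indic ?setIT//.
Qed.

Lemma poisson_solution : exists u : G * chi -> R,
  [/\ measurable_fun setT u, forall z, `|u z| <= M / eps &
      forall z, u z = h z + \int[PT z]_y u (z.1, y)].
Proof.
exists u; split => // -[g x].
have nu0 : \int[nu]_y u (g, y) = 0.
  have mI : measurable_fun setT (fun x => \int[PT (g, x)]_y u (g, y)).
    apply: (measurableT_comp (f := fun z => \int[PT z]_y u (z.1, y))) => //.
    apply: (@measurable_Rintegral_kernel _ _ _ _ _ PT (fun z => u (z.1.1, z.2)) (M / eps)).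
      apply: measurableT_comp => //; apply: measurable_fun_pair => //.
      exact: measurableT_comp.
    by move=> z.
  have IB y : `|\int[PT (g, y)]_y u (g, y)| <= M / eps.
    exact: (Rintegral_bounded (PT1 _) (msec g mu) (fun x => uM _)).
  (* Both sides contain the [pi_ g]-mean of [u], which cancels; [h] has mean zero, so [eps] times
     the [nu]-mean of [u] is all that is left. *)
  have := stat_Rintegral g mu uM.
  have E y : \int[PT (g, y)]_y u (g, y) =
      (u (g, y) - h (g, y)) + eps * \int[nu]_y u (g, y).
    by have := residual_u (g, y); rewrite /residual_op/=; lra.
  under eq_Rintegral do rewrite E.
  have iu : (pi_ g).-integrable setT (EFin \o (fun x => u (g, x))).
    exact: (integrable_bounded (pi1 g)) (msec _ mu) (fun x => uM _).
  have ih : (pi_ g).-integrable setT (EFin \o (fun x => h (g, x))).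
    exact: (integrable_bounded (pi1 g)) (msec _ mh) (fun x => hM _).
  rewrite RintegralD//; last 2 first.
  - apply: (@integrable_bounded _ _ _ _ (pi1 g) _ (M / eps + M)) => [|x'].
      by apply: measurable_funB; exact: msec.
    by rewrite (le_trans (ler_normB _ _))// lerD.
  - exact: (@integrable_bounded _ _ _ _ (pi1 g) _ `|eps * \int[nu]_y u (g, y)|).
  rewrite RintegralB// h_centred (Rintegral_const (pi1 g)) subr0 => /eqP.
  rewrite -subr_eq0 addrAC subrr add0r mulf_eq0 gt_eqF/= ?orbF; last by case/andP: eps01.
  by move=> /eqP.
by have := residual_u (g, x); rewrite /residual_op/= nu0; lra.
Qed.

End poisson_equation.

(** * Segments *)

Section segments.
Context {R : realType} {dG d dO : measure_display} {G : measurableType dG}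
  {chi : measurableType d} {Omega : measurableType dO}.
Variables (c : clock R) (ev : R -> Omega -> chi)
  (P : R -> R.-pker (G * chi) ~> chi) (Q : R.-pker (G * chi) ~> Omega)
  (pi_ : G -> probability chi R) (f : chi -> R) (M : R).
Hypotheses (T_gt0 : 0 < horizon c) (evP : is_path_space c ev)
  (QP : forall g, is_path_law c ev (fun t x => P t (g, x)) (fun x => Q (g, x)))
  (stat : forall g, stationary c (fun t x => P t (g, x)) (pi_ g))
  (mf : measurable_fun setT f) (fM : forall x, `|f x| <= M)
  (f_centred : forall g, (\int[pi_ g]_x (f x)%:E = 0)%E).

Lemma tick0 : tick c 0 = 0.
Proof. by rewrite /tick; case: c => // _; rewrite truncn0. Qed.

Lemma measurable_ev t : 0 <= t <= horizon c -> measurable_fun setT (ev t).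
Proof. by case: evP => _ + _; exact. Qed.

Lemma path_law_marginal z t A : 0 <= t <= horizon c -> measurable A ->
  Q z (ev t @^-1` A) = P (tick c t) z A.
Proof.
case: z => g x tT mA.
have := QP g x (A := fun=> A) (ts := [:: t]) (fun=> mA).
rewrite /= tick0 subr0 integral_cst// mul1e => <- //.
- congr (Q (g, x) _); apply/seteqP; split => phi /=.
    by move=> Aphi t'; rewrite inE => /eqP ->.
  by apply; rewrite inE.
- by move=> t'; rewrite inE => /eqP ->.
Qed.

Lemma path_law_end z A : measurable A ->
  Q z (ev (horizon c) @^-1` A) = P (horizon c) z A.
Proof.
move=> mA; rewrite path_law_marginal ?lexx ?ltW//.
by congr (P _ z A); rewrite /tick /horizon; case: c => // T; rewrite natrK.
Qed.

Let F := segment_mean c ev f.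

(* [f' (s, phi)] is f (phi s) for the times s that count and 0 for the others,
   where [ev] need not be measurable. *)
Lemma segment_mean_average :
  exists (tau : probability (measurableTypeR R) R) (f' : measurableTypeR R * Omega -> R),
  [/\ measurable_fun setT f', forall z, `|f' z| <= M,
      forall phi, F phi = \int[tau]_s f' (s, phi) &
      forall s, (forall phi, f' (s, phi) = 0) \/
        exists2 t, 0 <= t <= horizon c /\ times c (tick c t) &
          forall phi, f' (s, phi) = f (ev t phi)].
Proof.
have M0 : 0 <= M by exact: le_trans (normr_ge0 _) (fM point).
have f0 x : 0 <= f x + M by have := fM x; rewrite ler_norml; lra.
move: T_gt0 evP; rewrite /F; case: c => [T|T] /= T0 [_ mev jev].
  pose D := `[0, T]%classic `*` [set: Omega].
  pose f' := (fun z : measurableTypeR R * Omega => f (ev z.1 z.2)) \_ D.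
  have mf' : measurable_fun setT f'.
    apply/measurable_restrict => //; first exact: measurableX.
    by rewrite setTI; exact: measurableT_comp mf jev.
  have f'M z : `|f' z| <= M by rewrite /f' patchE; case: ifPn; rewrite ?normr0.
  have f'E s phi : 0 <= s <= T -> f' (s, phi) = f (ev s phi).
    by move=> sT; rewrite /f' patchE mem_set//; split => //=; rewrite in_itv.
  exists (uniform_prob T0 : probability (measurableTypeR R) R), f'; split => //; last first.
    move=> s; have [sT|sT] := boolP (0 <= s <= T); [right|left].
      by exists s => [|phi]; [split => //; case/andP: sT|exact: f'E].
    move=> phi; rewrite /f' patchE memNset// => -[/=]; rewrite in_itv/=.
    by rewrite (negbTE sT).
  move=> phi.
  have mg : measurable_fun setT (fun s => f' (s, phi)).
    by apply: measurableT_comp => //; exact: measurable_pair2.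
  have lebT : lebesgue_measure `[0, T]%classic = T%:E.
    by rewrite lebesgue_measure_itv/= lte_fin T0 -EFinB subr0.
  have If (h : R -> R) (B : R) : measurable_fun setT h -> (forall s, `|h s| <= B) ->
      lebesgue_measure.-integrable `[0, T] (EFin \o h).
    move=> mh hM; apply: measurable_bounded_integrable => //.
    - by rewrite [X in (X < _)%E]lebT ltry.
    - exact: measurable_funTS.
    - exists B; split; first exact: num_real.
      by move=> y My s _; rewrite /= (le_trans (hM s))// ltW.
  have IM : lebesgue_measure.-integrable `[0, T] (EFin \o cst M).
    by apply: (If _ M) => // s; rewrite ger0_norm.
  apply: (@addIr _ M); apply: EFin_inj.
  rewrite -Rintegral_shift//; last exact: probability_setT.
  rewrite integral_uniform; last 2 first.
  - by apply/measurable_EFinP; exact: measurable_funD.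
  - by move=> s; have := f'M (s, phi); rewrite lee_fin ler_norml; lra.
  rewrite -[X in (_ * X)%E]fineK; last first.
    apply: integrable_fin_num => //.
    apply: (If (fun s => f' (s, phi) + M) (M + M)); first exact: measurable_funD.
    by move=> s; rewrite (le_trans (ler_normD _ _))// lerD// ger0_norm.
  rewrite -EFinM; congr (_%:E); rewrite -/(Rintegral _ _ _) RintegralD//; last first.
    exact: (If _ M).
  rewrite Rintegral_cst//= [X in fine X]lebT/=.
  rewrite subr0 mulrDr (mulrC M) mulKf ?gt_eqF//; congr (_ * _ + _).
  by apply: eq_Rintegral => s /set_mem/=; rewrite in_itv/= => sT; rewrite f'E.
have T1 : (0 < T)%N by rewrite -(ltr0n R).
(* In discrete time [tau] is the uniform law on 0, ..., T-1, obtained by representing the averaging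
   functional. With it both clocks write the segment mean as an integral over times. *)
pose L (k : measurableTypeR R -> \bar R) := (T%:R^-1%:E * \sum_(0 <= s < T) k s%:R)%E.
have LP : ge0_functional L.
  apply: gf_mul; first by rewrite invr_ge0.
  elim: (T) => [|N IH].
    rewrite (_ : (fun k => _) = fun=> 0%E); last first.
      by apply/funext => k; rewrite big_geq.
    split => //; first by move=> *; rewrite adde0.
      by move=> *; rewrite mule0.
    by move=> *; exact: cvg_cst.
  rewrite (_ : (fun k => _) =
      fun k => (\sum_(0 <= s < N) k s%:R + k N%:R)%E); last first.
    by apply/funext => k; rewrite big_nat_recr.
  by apply: gf_plus => //; exact: gf_eval.
have L1 : L (fun=> 1%E) = 1%E.
  rewrite /L sumEFin -EFinM sumr_const_nat subn0.
  by rewrite mulVf// gt_eqF.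
have [tau tauL] := gf_probability LP L1.
(* Only finitely many times count, so measurability of [ev] at each of them suffices for joint
   measurability of this sum. *)
pose f' (z : measurableTypeR R * Omega) :=
  \sum_(0 <= i < T) \1_[set i%:R : R] z.1 * f (ev i%:R z.2).
have f'E (i : nat) phi : (i < T)%N -> f' (i%:R, phi) = f (ev i%:R phi).
  move=> iT; rewrite /f' big_mkord (bigD1 (Ordinal iT))//= indicE mem_set// mul1r.
  rewrite big1 ?addr0// => j ji; rewrite indicE memNset ?mul0r//= => /eqP.
  by rewrite eqr_nat => /eqP ij; case/eqP: ji; exact: val_inj.
have f'0 s phi : (forall i, (i < T)%N -> s <> i%:R) -> f' (s, phi) = 0.
  move=> si; rewrite /f' big_mkord big1// => i _.
  by rewrite indicE memNset ?mul0r//=; exact: si.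
have cases (s : R) : (exists2 i, (i < T)%N & s = i%:R) \/ (forall i, (i < T)%N -> s <> i%:R).
  have [|h] := pselect (exists2 i, (i < T)%N & s = i%:R); first by left.
  by right => i iT si; apply: h; exists i.
have f'M z : `|f' z| <= M.
  case: z => s phi; have [[i iT ->]|/f'0 ->] := cases s; first by rewrite f'E.
  by rewrite normr0.
have evi (i : nat) : (i < T)%N -> 0 <= (i%:R : R) <= T%:R.
  by move=> iT; rewrite ler0n ler_nat ltnW.
have mf' : measurable_fun setT f'.
  rewrite /f'; under eq_fun do rewrite big_mkord.
  apply: measurable_sum => i; apply: measurable_funM.
    have mi : measurable_fun setT (\1_[set (i : nat)%:R] : measurableTypeR R -> R).
      by apply: measurable_indic; exact: measurable_set1.
    exact: (measurableT_comp mi measurable_fst).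
  apply: measurableT_comp => //.
  apply: (measurableT_comp (f := ev (i : nat)%:R)) => //.
  exact/mev/evi.
exists tau, f'; split => //.
- move=> phi.
  have mg : measurable_fun setT (fun s => f' (s, phi)).
    by apply: measurableT_comp => //; exact: measurable_pair2.
  apply: (@addIr _ M); apply: EFin_inj.
  rewrite -Rintegral_shift//; last exact: probability_setT.
  rewrite -tauL; last 2 first.
  - by move=> s; have := f'M (s, phi); rewrite lee_fin ler_norml; lra.
  - by apply/measurable_EFinP; exact: measurable_funD.
  rewrite /L sumEFin -EFinM; congr (_%:E).
  rewrite big_split/= sumr_const_nat subn0 mulrDr -[M *+ T]mulr_natl mulKf ?gt_eqF//.
  congr (_ * _ + _); rewrite !big_nat.
  by apply: eq_bigr => i /andP[_ iT]; rewrite f'E.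
- move=> s; have [[i iT ->]|h] := cases s; [right|left => phi; exact: f'0].
  exists i%:R; last by move=> phi; rewrite f'E.
  by split; [exact: evi|exists i => //; rewrite natrK].
Qed.

Lemma measurable_segment_mean : measurable_fun setT F.
Proof.
have [tau [f' [mf' f'M FE _]]] := segment_mean_average.
rewrite (_ : F = fun phi => \int[tau]_s f' (s, phi)); last exact/funext.
pose k : R.-pker Omega ~> measurableTypeR R :=
  kprobability (measurable_cst (tau : pprobability (measurableTypeR R) R)).
apply: (@measurable_Rintegral_kernel _ _ _ _ _ k (fun z => f' (z.2, z.1)) M) => //.
by apply: measurableT_comp => //; apply: measurable_fun_pair.
Qed.

Lemma segment_mean_le phi : `|F phi| <= M.
Proof.
have [tau [f' [mf' f'M FE _]]] := segment_mean_average.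
rewrite FE; apply: Rintegral_bounded => //; first exact: probability_setT.
by apply: measurableT_comp => //; exact: measurable_pair2.
Qed.

(** Let [rho] be the law of a segment started from [pi_ g]. By stationarity its marginal at every
    time that counts is [pi_ g], so f has mean zero there; exchanging [rho] with the time average
    [tau] concludes. Representing the iterated integral by the single measure [rho] is what makes
    Tonelli applicable. *)
Lemma segment_mean_centred g : \int[pi_ g]_x \int[Q (g, x)]_phi F phi = 0.
Proof.
have [tau [f' [mf' f'M FE f'ev]]] := segment_mean_average.
pose L (k : Omega -> \bar R) := (\int[pi_ g]_x \int[Q (g, x)]_phi k phi)%E.
have mQ (k : Omega -> \bar R) : (forall phi, 0 <= k phi)%E -> measurable_fun setT k ->
    measurable_fun setT (fun x => \int[Q (g, x)]_phi k phi)%E.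
  move=> k0 mk.
  apply: (measurableT_comp (f := fun z => \int[Q z]_phi k phi)%E) => //.
  by apply: measurable_fun_integral_kernel => // U mU; exact: measurable_kernel.
have LP : ge0_functional L.
  apply: gf_integral => [x|k k0 mk]; last exact: mQ.
  by apply: gf_integral => [y|k k0 mk] //; exact: gf_eval.
have L1 : L (fun=> 1%E) = 1%E.
  rewrite /L; under eq_integral do rewrite integral_cst// mul1e prob_kernel.
  by rewrite integral_cst// mul1e; exact: probability_setT.
have [rho rhoL] := gf_probability LP L1.
have rho1 : rho setT = 1%E by exact: probability_setT.
have pi1 : pi_ g setT = 1%E by exact: probability_setT.
have M0 : 0 <= M by exact: le_trans (normr_ge0 _) (fM point).
have f0 x : 0 <= f x + M by have := fM x; rewrite ler_norml; lra.
have rho_ev t : 0 <= t <= horizon c -> times c (tick c t) ->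
    (\int[rho]_phi (f (ev t phi) + M)%:E = M%:E)%E.
  move=> tT ct; have mt := measurable_ev tT.
  have mfM : measurable_fun setT (fun x => (f x + M)%:E).
    by apply/measurable_EFinP; exact: measurable_funD.
  transitivity (\int[pushforward rho (ev t)]_x (f x + M)%:E)%E.
    by rewrite ge0_integral_pushforward// => y _; rewrite lee_fin.
  transitivity (\int[pi_ g]_x (f x + M)%:E)%E; last first.
    by rewrite Rintegral_shift// /Rintegral f_centred/= add0r.
  apply: eq_measure_integral => A mA _.
  have mtA : measurable (ev t @^-1` A) by rewrite -[X in measurable X]setTI; exact: mt.
  rewrite -[LHS]/(rho (ev t @^-1` A)) -(setIT (_ @^-1` _)).
  rewrite -integral_indic// -rhoL//; last first.
    by apply/measurable_EFinP; exact: measurable_indic.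
  rewrite [RHS](stat g ct mA); apply: eq_integral => x _.
  by rewrite integral_indic// setIT path_law_marginal.
have rho_f' s : (\int[rho]_phi (f' (s, phi) + M)%:E = M%:E)%E.
  have [s0|[t [tT ct] st]] := f'ev s.
    under eq_integral do rewrite s0 add0r.
    by rewrite integral_cst// [X in (_ * X)%E]rho1 mule1.
  by under eq_integral do rewrite st; exact: rho_ev.
have mF := measurable_segment_mean.
have mFM : measurable_fun setT (fun phi => (F phi + M)%:E).
  by apply/measurable_EFinP; exact: measurable_funD.
have F0 phi : (0 <= (F phi + M)%:E)%E.
  by have := segment_mean_le phi; rewrite ler_norml lee_fin; lra.
have Q1 x : Q (g, x) setT = 1%E by exact: prob_kernel.
have tau1 : tau setT = 1%E by exact: probability_setT.
have mI : measurable_fun setT (fun x => \int[Q (g, x)]_phi F phi).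
  rewrite (_ : (fun x => _) =
      (fun x => fine (\int[Q (g, x)]_phi (F phi + M)%:E)%E - M)).
    apply: measurable_funB => //; apply: measurableT_comp => //.
    exact: mQ.
  apply/funext => x.
  by rewrite (Rintegral_shift (Q1 x) mF segment_mean_le)/= addrK.
have IM x : `|\int[Q (g, x)]_phi F phi| <= M.
  exact: (Rintegral_bounded (Q1 x) mF segment_mean_le).
apply: (@addIr _ M); rewrite add0r; apply: EFin_inj.
rewrite -(Rintegral_shift pi1 mI IM).
under eq_integral do rewrite -(Rintegral_shift (Q1 _) mF segment_mean_le).
rewrite -[LHS]/(L (fun phi => (F phi + M)%:E)) rhoL//.
transitivity (\int[rho]_phi \int[tau]_s (f' (s, phi) + M)%:E)%E.
  apply: eq_integral => phi _; rewrite FE (Rintegral_shift tau1)//.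
  by apply: measurableT_comp => //; exact: measurable_pair2.
rewrite (@fubini_tonelli _ _ _ _ _ rho tau (fun z => (f' (z.2, z.1) + M)%:E))//=.
- under eq_integral do rewrite rho_f'.
  by rewrite integral_cst// [X in (_ * X)%E]tau1 mule1.
- apply/measurable_EFinP; apply: measurable_funD => //.
  by apply: measurableT_comp => //; apply: measurable_fun_pair.
- by move=> [phi s]; have := f'M (s, phi); rewrite ler_norml lee_fin/=; lra.
Qed.

End segments.

(** * The split chain *)

Section kernel_pullback.
Local Open Scope ereal_scope.
Context {R : realType} {d0 d d'} {W : measurableType d0} {X : measurableType d}
  {Y : measurableType d'}.
Variables (k : R.-pker X ~> Y) (h : W -> X).

(** Used to run the segment kernel from a random parameter and endpoint. The measurability proof is
    an argument so that the kernel structure can be inferred from the term itself. *)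
Definition kpullback (mh : measurable_fun setT h) (w : W) :
  {measure set Y -> \bar R} := k (h w).

Hypothesis mh : measurable_fun setT h.

Let measurable_kpullback U : measurable U ->
  measurable_fun setT (kpullback mh ^~ U).
Proof. by move=> mU; exact: measurableT_comp (measurable_kernel k U mU) mh. Qed.

HB.instance Definition _ := isKernel.Build _ _ _ _ _ (kpullback mh)
  measurable_kpullback.

Let kpullback_prob w : kpullback mh w setT = 1.
Proof. exact: prob_kernel. Qed.

HB.instance Definition _ := Kernel_isProbability.Build _ _ _ _ _
  (kpullback mh) kpullback_prob.

End kernel_pullback.

Section split_chain.
Local Open Scope ereal_scope.
Context {R : realType} {dG d dO : measure_display} {G : measurableType dG}
  {chi : measurableType d} {Omega : measurableType dO}.
Variables (PT : R.-pker (G * chi) ~> chi) (Q : R.-pker (G * chi) ~> Omega)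
  (e : Omega -> chi) (nu : probability chi R) (eps : R)
  (dnu deta : G -> chi -> chi -> R).
Hypotheses (me : measurable_fun setT e)
  (Qe : forall z A, measurable A -> Q z (e @^-1` A) = PT z A)
  (eps01 : (0 < eps < 1)%R)
  (mdnu : measurable_fun setT (fun z : G * chi * chi => dnu z.1.1 z.1.2 z.2))
  (mdeta : measurable_fun setT (fun z : G * chi * chi => deta z.1.1 z.1.2 z.2))
  (dnuP : forall g x, is_density nu (PT (g, x)) (dnu g x))
  (detaP : forall g x, is_density (eta (PT (g, x)) eps nu) (PT (g, x)) (deta g x)).

Definition split_density (b : bool) (z : G * chi) (y : chi) : R :=
  (if b then dnu else deta) z.1 z.2 y.

(** One move of the split chain, as an operator on test functions of the next state, with the
    Bernoulli flag averaged explicitly. The old path matters only through its endpoint, the second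
    component of [z]. In this form it is a [ge0_functional]. *)
Definition split_step (z : G * chi) (b : bool) (k : Omega * bool -> \bar R) :=
  \int[Q z]_phi ((split_density b z (e phi))%:E *
    (eps%:E * k (phi, true) + (1 - eps)%:E * k (phi, false))).

Let eps_ge0 : (0 <= eps)%R. Proof. by rewrite ltW//; case/andP: eps01. Qed.
Let eps_le1 : (0 <= 1 - eps)%R.
Proof. by rewrite subr_ge0 ltW//; case/andP: eps01. Qed.

Let density_ge0 b z y : (0 <= split_density b z y)%R.
Proof.
by case: z => g x; rewrite /split_density; case: b => /=;
  [case: (dnuP g x)|case: (detaP g x)].
Qed.

Let measurable_density b z : measurable_fun setT (split_density b z).
Proof.
by case: z => g x; rewrite /split_density; case: b => /=;
  [case: (dnuP g x)|case: (detaP g x)].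
Qed.

Let mix_ge0 (k : Omega * bool -> \bar R) phi : (forall z, 0 <= k z) ->
  0 <= eps%:E * k (phi, true) + (1 - eps)%:E * k (phi, false).
Proof. by move=> k0; rewrite adde_ge0// mule_ge0. Qed.

Lemma integral_path_end z (k : chi -> \bar R) : (forall y, 0 <= k y) ->
  measurable_fun setT k -> \int[Q z]_phi k (e phi) = \int[PT z]_y k y.
Proof.
move=> k0 mk; transitivity (\int[pushforward (Q z) e]_y k y).
  by rewrite ge0_integral_pushforward.
by apply: eq_measure_integral => A mA _; exact: Qe.
Qed.

Lemma split_density_mass b z : \int[Q z]_phi (split_density b z (e phi))%:E = 1.
Proof.
rewrite (integral_path_end z (k := fun y => (split_density b z y)%:E)); last 2 first.
- by move=> y; rewrite lee_fin.
- by apply/measurable_EFinP.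
case: z => g x; rewrite /split_density; case: b => /=.
  by case: (dnuP g x) => _ _ <- //; exact: probability_setT.
case: (detaP g x) => _ _ <- //; rewrite /eta prob_kernel.
rewrite [X in (_ - _ * X)%E](_ : _ = 1); last exact: probability_setT.
rewrite mule1 -EFinB -EFinM mulVf// gt_eqF// subr_gt0.
by case/andP: eps01.
Qed.

Lemma split_step_functional z b : ge0_functional (split_step z b).
Proof.
apply: gf_integral => [phi|k k0 mk].
  by apply: gf_mul => //; apply: gf_plus; apply: gf_mul => //; exact: gf_eval.
apply: emeasurable_funM.
  by apply/measurable_EFinP; exact: measurableT_comp.
apply: emeasurable_funD; apply: measurable_funeM.
- by apply: measurableT_comp => //; exact: measurable_pair2.
- by apply: measurableT_comp => //; exact: measurable_pair2.
Qed.

Lemma split_step1 z b : split_step z b (fun=> 1) = 1.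
Proof.
rewrite -[RHS](split_density_mass b z); apply: eq_integral => phi _.
by rewrite !mule1 -EFinD addrC subrK mule1.
Qed.

Lemma measurable_split_step d0 (W : measurableType d0) (gx : W -> G * chi)
    (b : W -> bool) (J : W * (Omega * bool) -> \bar R) :
  measurable_fun setT gx -> measurable_fun setT b ->
  (forall z, 0 <= J z) -> measurable_fun setT J ->
  measurable_fun setT (fun w => split_step (gx w) (b w) (fun z => J (w, z))).
Proof.
move=> mgx mb J0 mJ.
apply: (measurable_fun_integral_finite_kernel
  (fun z : W * Omega => (split_density (b z.1) (gx z.1) (e z.2))%:E *
    (eps%:E * J (z.1, (z.2, true)) + (1 - eps)%:E * J (z.1, (z.2, false))))
  (kpullback Q mgx)).
  by move=> [w phi] /=; rewrite mule_ge0//= ?lee_fin// (mix_ge0 (k := fun z => J (w, z))).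
apply: emeasurable_funM.
  apply/measurable_EFinP.
  rewrite (_ : (fun _ => _) = (fun z : W * Omega => if b z.1
      then dnu (gx z.1).1 (gx z.1).2 (e z.2)
      else deta (gx z.1).1 (gx z.1).2 (e z.2))); last first.
    by apply/funext => z; rewrite /split_density; case: (b _).
  have mp : measurable_fun setT (fun z : W * Omega => (gx z.1, e z.2)).
    by apply: measurable_fun_pair => /=; exact: measurableT_comp.
  have mp' : measurable_fun setT (fun z : W * Omega =>
      (((gx z.1).1, (gx z.1).2), e z.2)).
    by under eq_fun do rewrite -surjective_pairing.
  apply: measurable_fun_ifT.
  - exact: measurableT_comp.
  - exact: (measurableT_comp mdnu mp').
  - exact: (measurableT_comp mdeta mp').
apply: emeasurable_funD; apply: measurable_funeM; apply: measurableT_comp => //;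
  apply: measurable_fun_pair => //; exact: measurable_fun_pair.
Qed.

Lemma split_kernelE (c : clock R) (ev : R -> Omega -> chi) g z B :
  e = ev (horizon c) ->
  split_kernel c ev eps (fun x => Q (g, x)) (dnu g) (deta g) z B =
  split_step (g, e z.1) z.2 (fun z' => \d_z' B).
Proof.
move=> ee; rewrite /split_kernel -ee; apply: eq_integral => phi _.
rewrite bernoulli_probE; last by rewrite eps_ge0 -subr_ge0.
by rewrite /split_density; case: (z.2).
Qed.

(* eps nu + (1 - eps) eta = P^T, so the two densities mix to 1 almost everywhere. *)
Lemma density_mixture z (k : Omega -> \bar R) : (forall phi, 0 <= k phi) ->
  measurable_fun setT k ->
  eps%:E * \int[Q z]_phi ((split_density true z (e phi))%:E * k phi) +
  (1 - eps)%:E * \int[Q z]_phi ((split_density false z (e phi))%:E * k phi) =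
  \int[Q z]_phi k phi.
Proof.
move=> k0 mk.
have mdk b : measurable_fun setT (fun phi => (split_density b z (e phi))%:E * k phi).
  apply: emeasurable_funM => //.
  by apply/measurable_EFinP; exact: measurableT_comp.
have dk0 b phi : 0 <= (split_density b z (e phi))%:E * k phi.
  by rewrite mule_ge0// lee_fin.
rewrite -!ge0_integralZl_EFin// -ge0_integralD//; last 4 first.
- by move=> phi _; rewrite mule_ge0.
- exact: measurable_funeM.
- by move=> phi _; rewrite mule_ge0.
- exact: measurable_funeM.
pose mix y := (eps * split_density true z y + (1 - eps) * split_density false z y)%R.
have mmix : measurable_fun setT (EFin \o mix).
  by apply/measurable_EFinP; apply: measurable_funD; apply: measurable_funM.
have mixP : ae_eq (PT z) setT (cst 1) (EFin \o mix).
  apply: integral_ae_eq => //.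
    apply: (@integrable_bounded _ _ _ _ _ (cst 1%R) 1%R) => //.
      exact: prob_kernel.
    by move=> ?; rewrite normr1.
  move=> A _ mA; rewrite integral_cst// mul1e.
  have mAd b : measurable_fun A (fun y => (split_density b z y)%:E).
    by apply: measurable_funTS; apply/measurable_EFinP.
  have -> : \int[PT z]_(y in A) (EFin \o mix) y =
      eps%:E * \int[PT z]_(y in A) (split_density true z y)%:E +
      (1 - eps)%:E * \int[PT z]_(y in A) (split_density false z y)%:E.
    rewrite -!ge0_integralZl_EFin//; last 2 first.
    - by move=> y _; rewrite lee_fin.
    - by move=> y _; rewrite lee_fin.
    rewrite -ge0_integralD//.
    - by move=> y _; rewrite mule_ge0// lee_fin.
    - exact: measurable_funeM.
    - by move=> y _; rewrite mule_ge0// lee_fin.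
    - exact: measurable_funeM.
  case: z {mdk dk0 mix mmix mAd} => g x; rewrite /split_density/=.
  case: (dnuP g x) => _ _ <- //; case: (detaP g x) => _ _ <- //.
  rewrite /eta muleA -EFinM divff ?mul1e; last first.
    by rewrite gt_eqF// subr_gt0; case/andP: eps01.
  have nuf : nu A \is a fin_num by rewrite fin_num_measure.
  rewrite addeCA subee ?adde0// fin_numM//.
have [N [mN N0 subN]] := mixP.
apply: ae_eq_integral => //.
- apply: emeasurable_funD; exact: measurable_funeM.
(* P^T is the image of the segment law under the endpoint map, so its null sets pull back to null
   sets of paths. *)
- exists (e @^-1` N); split.
  + by rewrite -[X in measurable X]setTI; exact: me.
  + by rewrite [LHS]Qe.
  + move=> phi /= H; apply: subN => /= /(_ I) E; apply: H => _.
    rewrite !muleA -ge0_muleDl; last 2 first.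
      by rewrite mule_ge0// lee_fin; exact: (density_ge0 true).
      by rewrite mule_ge0// lee_fin; exact: (density_ge0 false).
    by rewrite -!EFinM -EFinD -[X in X%:E]/(mix (e phi)) -[X in X * _]E mul1e.
Qed.

Variables (F : Omega -> R) (M : R) (u : G * chi -> R).
Hypotheses (mF : measurable_fun setT F) (FM : forall phi, (`|F phi| <= M)%R)
  (mu : measurable_fun setT u) (uM : forall z, (`|u z| <= M / eps)%R)
  (uP : forall z, (u z = \int[Q z]_phi F phi + \int[PT z]_y u (z.1, y))%R).

Let B : R := (M + M / eps)%R.

(** [g'] is the conditional mean of F + u given the previous endpoint and flag, raised by [B], a
    bound for |F + u|; hence the range from 0 to [B + B]. The [M] on both sides of the equation only
    keeps the test function nonnegative. *)
Lemma split_poisson_solution : exists g' : G * chi * bool -> R,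
  [/\ measurable_fun setT g', forall z, (0 <= g' z <= B + B)%R &
      forall z b, split_step z b
        (fun p => (F p.1 + M + g' ((z.1, e p.1), p.2))%:E) =
        (g' (z, b) + M)%:E].
Proof.
have e0 : (0 < eps)%R by case/andP: eps01.
have M0 : (0 <= M)%R by exact: le_trans (normr_ge0 _) (FM point).
have B0 : (0 <= B)%R by rewrite addr_ge0// divr_ge0// ltW.
have Q1 z : Q z setT = 1 by exact: prob_kernel.
pose s (z : G * chi) (phi : Omega) := (F phi + u (z.1, e phi))%R.
have mue (z : G * chi) : measurable_fun setT (fun phi => u (z.1, e phi)).
  apply: (measurableT_comp (f := fun y => u (z.1, y))) => //.
  by apply: measurableT_comp => //; exact: measurable_pair1.
have ms z : measurable_fun setT (s z) by exact: measurable_funD.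
have sB z phi : (`|s z phi| <= B)%R.
  by rewrite (le_trans (ler_normD _ _))// lerD.
have sB0 z phi : (0 <= s z phi + B <= B + B)%R.
  by have := sB z phi; rewrite ler_norml; lra.
have sB0e z phi : 0 <= (s z phi + B)%:E by rewrite lee_fin; case/andP: (sB0 z phi).
have msB z : measurable_fun setT (fun phi => (s z phi + B)%:E).
  by apply/measurable_EFinP; exact: measurable_funD.
have msB2 z : measurable_fun setT (fun p : Omega * bool => (s z p.1 + B)%:E).
  exact: (measurableT_comp (msB z) measurable_fst).
pose gp (z : G * chi * bool) := split_step z.1 z.2 (fun p => (s z.1 p.1 + B)%:E).
have mgp : measurable_fun setT gp.
  apply: (@measurable_split_step _ (G * chi * bool)%type fst snd
      (fun w => (s w.1.1 w.2.1 + B)%:E)) => //.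
  apply/measurable_EFinP; apply: measurable_funD => //; apply: measurable_funD.
    by apply: measurableT_comp => //; exact: measurableT_comp.
  apply: measurableT_comp => //; apply: measurable_fun_pair => /=.
    by do 2 apply: measurableT_comp => //.
  by apply: measurableT_comp => //; exact: measurableT_comp.
have step_cst z b r : (0 <= r)%R -> split_step z b (fun=> r%:E) = r%:E.
  move=> r0; rewrite -[RHS]mule1 -(split_step1 z b).
  rewrite -(gf_scale (split_step_functional z b) r0)//.
  by under [in RHS]eq_fun do rewrite mule1.
have gp0 z : 0 <= gp z by exact: (gf_ge0 (split_step_functional _ _)).
have gpB z : gp z <= (B + B)%:E.
  rewrite -(step_cst z.1 z.2 (B + B)%R)//; last exact: addr_ge0.
  apply: (gf_le (split_step_functional _ _)) => // p.
  by rewrite lee_fin; case/andP: (sB0 z.1 p.1).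
pose g' z := fine (gp z).
have g'E z : (g' z)%:E = gp z.
  by rewrite fineK// ge0_fin_numE// (le_lt_trans (gpB z))// ltry.
have gpE z b : gp (z, b) =
    \int[Q z]_phi ((split_density b z (e phi))%:E * (s z phi + B)%:E).
  apply: eq_integral => phi _; rewrite -muleDl//.
  by rewrite -EFinD addrC subrK mul1e.
(* Averaging over the flag turns the two densities into 1 by [density_mixture], and the Poisson
   equation [uP] identifies the outcome as [u], raised by [B]. *)
have mixture z : (eps * g' (z, true) + (1 - eps) * g' (z, false) = u z + B)%R.
  apply: EFin_inj; rewrite EFinD !EFinM !g'E !gpE density_mixture//.
  rewrite (Rintegral_shift (Q1 z) (ms z) (sB z)).
  congr (_ + _)%:E; rewrite [RHS]uP /s RintegralD//; last 2 first.
  - exact: (integrable_bounded (Q1 z) mF FM).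
  - exact: (integrable_bounded (Q1 z) (mue z) (fun phi => uM _)).
  congr (_ + _)%R; apply: (@addIr _ (M / eps)%R); apply: EFin_inj.
  rewrite -(Rintegral_shift (Q1 z) (mue z) (fun phi => uM _)).
  have mu1 : measurable_fun setT (fun y => u (z.1, y)).
    by apply: measurableT_comp => //; exact: measurable_pair1.
  rewrite -(Rintegral_shift _ mu1 (fun y => uM _)); last exact: prob_kernel.
  apply: (integral_path_end z (k := fun y => (u (z.1, y) + M / eps)%:E)).
    by move=> y; have := uM (z.1, y); rewrite ler_norml lee_fin; lra.
  by apply/measurable_EFinP; exact: measurable_funD.
exists g'; split.
- exact: measurableT_comp.
- by move=> z; rewrite -!lee_fin g'E gp0 gpB.
move=> z b; rewrite EFinD g'E -[X in _ + X](step_cst z b M M0).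
rewrite -(gf_add (split_step_functional z b))//.
apply: eq_integral => phi _; congr (_ * _).
apply: (congr1 EFin) => /=.
by have := mixture (z.1, e phi); rewrite /s; lra.
Qed.

End split_chain.

(** * Growth of martingales with bounded increments *)

(** From 1 - x <= exp(-x) and (1 - x)(1 + x + 2x^2) = 1 + x^2 (1 - 2x) >= 1. There is no lower limit
    on [x]. *)
Lemma expR_le_quadratic (R : realType) (x : R) : x <= 2^-1 ->
  expR x <= 1 + x + 2 * x ^+ 2.
Proof.
move=> x2; have x1 : 0 < 1 - x by lra.
have q0 : 0 <= 1 + x + 2 * x ^+ 2 by nra.
have h : 1 - x <= expR (- x) by exact: expR_ge1Dx.
have E : expR x * expR (- x) = 1 by rewrite -expRD subrr expR0.
have e0 := expR_gt0 x.
have : expR x * (1 - x) <= 1 by rewrite (le_trans (ler_wpM2l (ltW e0) h))// E.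
have k : 1 <= (1 - x) * (1 + x + 2 * x ^+ 2).
  have -> : (1 - x) * (1 + x + 2 * x ^+ 2) = 1 + x ^+ 2 * (1 - 2 * x) by ring.
  by rewrite lerDl mulr_ge0 ?sqr_ge0//; lra.
by move=> /le_trans /(_ k); rewrite [expR x * _]mulrC ler_pM2l.
Qed.

Section bounded_martingale.
Context {R : realType} {dS : measure_display} {S : measurableType dS}.
Variables (Pr : probability S R) (D : nat -> S -> R) (a : R).
Hypotheses (a_gt0 : 0 < a) (mD : forall m, measurable_fun setT (D m))
  (Da : forall m w, `|D m w| <= a).

Definition partial_sum (m : nat) (w : S) : R := \sum_(0 <= i < m) D i w.

(** Conditional centring of the increment, tested against exactly those functions of the past that
    the exponential moments produce. *)
Hypothesis D_orth : forall m lam,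
  \int[Pr]_w (expR (lam * partial_sum m w) * D m w) = 0.

Let Pr1 : Pr setT = 1%E. Proof. exact: probability_setT. Qed.

Let mM m : measurable_fun setT (partial_sum m).
Proof. by rewrite /partial_sum; exact: measurable_sum. Qed.

Let Ma m w : `|partial_sum m w| <= a * m%:R.
Proof.
rewrite (le_trans (ler_norm_sum _ _ _))//.
rewrite (le_trans (ler_sum _ (fun i _ => Da i w)))//.
by rewrite sumr_const_nat subn0 mulr_natr.
Qed.

Let mE lam m : measurable_fun setT (fun w => expR (lam * partial_sum m w)).
Proof. by apply: measurableT_comp => //; exact: measurable_funM. Qed.

Let Eb lam m w : `|expR (lam * partial_sum m w)| <= expR (`|lam| * (a * m%:R)).
Proof.
rewrite ger0_norm ?expR_ge0// ler_expR (le_trans (ler_norm _))// normrM.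
by rewrite ler_wpM2l.
Qed.

Let iE lam m :
  Pr.-integrable setT (EFin \o (fun w => expR (lam * partial_sum m w))).
Proof. exact: (integrable_bounded Pr1 (mE lam m) (Eb lam m)). Qed.

(** Expand the last factor by [expR_le_quadratic], whose range of validity is the condition on
    [lam]. The linear term integrates to zero by [D_orth], and 1 + 2 (lam a)^2 is at most its
    exponential, so each step multiplies the bound by one such factor. *)
Lemma exp_moment_bound lam m : `|lam| * a <= 2^-1 ->
  \int[Pr]_w expR (lam * partial_sum m w) <= expR (2 * (lam * a) ^+ 2 * m%:R).
Proof.
move=> lama; elim: m => [|m IH].
  rewrite mulr0 expR0; under eq_Rintegral do rewrite /partial_sum big_geq// mulr0 expR0.
  by rewrite Rintegral_const.
rewrite -[m.+1%:R]natr1 mulrDr mulr1 expRD.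
apply: (@le_trans _ _ (\int[Pr]_w ((1 + 2 * (lam * a) ^+ 2) *
    expR (lam * partial_sum m w) + lam * (expR (lam * partial_sum m w) * D m w)))).
  have iED : Pr.-integrable setT (EFin \o (fun w => expR (lam * partial_sum m w) * D m w)).
    apply: (@integrable_bounded _ _ _ _ Pr1 _ (expR (`|lam| * (a * m%:R)) * a)).
      exact: measurable_funM.
    by move=> w; rewrite normrM ler_pM.
  apply: (@le_Rintegral_bounded _ _ _ _ Pr1 _ _ (expR (`|lam| * (a * m.+1%:R)))
    (`|1 + 2 * (lam * a) ^+ 2| * expR (`|lam| * (a * m%:R)) +
     `|lam| * (expR (`|lam| * (a * m%:R)) * a))) => //.
  - apply: measurable_funD; apply: measurable_funM => //.
    exact: measurable_funM.
  - move=> w; rewrite (le_trans (ler_normD _ _))// !normrM lerD//.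
      by rewrite ler_wpM2l.
    by rewrite ler_wpM2l// ler_pM.
  - move=> w; have -> : partial_sum m.+1 w = partial_sum m w + D m w.
      by rewrite /partial_sum big_nat_recr.
    rewrite mulrDr expRD [X in _ <= X + _]mulrC [X in _ <= _ + X]mulrCA -mulrDr.
    rewrite ler_pM2l ?expR_gt0//.
    have lD : `|lam * D m w| <= `|lam| * a by rewrite normrM ler_wpM2l.
    have := @expR_le_quadratic _ (lam * D m w).
    have -> : lam * D m w <= 2^-1 by rewrite (le_trans (ler_norm _))// (le_trans lD).
    move=> /(_ isT) /le_trans; apply.
    rewrite addrAC lerD2r// lerD2l// ler_pM2l//.
    rewrite !exprMn ler_wpM2l ?sqr_ge0//.
    by have := Da m w; rewrite ler_norml => /andP[? ?]; nra.
rewrite RintegralD//; last 2 first.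
- apply: (@integrable_bounded _ _ _ _ Pr1 _
    (`|1 + 2 * (lam * a) ^+ 2| * expR (`|lam| * (a * m%:R)))).
    exact: measurable_funM.
  by move=> w; rewrite normrM ler_wpM2l.
- apply: (@integrable_bounded _ _ _ _ Pr1 _
    (`|lam| * (expR (`|lam| * (a * m%:R)) * a))).
    by apply: measurable_funM => //; exact: measurable_funM.
  by move=> w; rewrite !normrM ler_wpM2l// ler_pM.
rewrite !RintegralZl//; last first.
  apply: (@integrable_bounded _ _ _ _ Pr1 _ (expR (`|lam| * (a * m%:R)) * a)).
    exact: measurable_funM.
  by move=> w; rewrite normrM ler_pM.
rewrite D_orth mulr0 addr0 mulrC ler_pM ?Rintegral_ge0//.
- by rewrite addr_ge0// mulr_ge0// sqr_ge0.
- exact: expR_ge1Dx.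
Qed.

(** Partial fractions: each weight is 1/(k+1) - 1/(k+2). *)
Lemma telescoping_weights N :
  \sum_(0 <= k < N) ((k.+1%:R * k.+2%:R)^-1 : R) <= 1.
Proof.
suff -> : \sum_(0 <= k < N) ((k.+1%:R * k.+2%:R)^-1 : R) = 1 - N.+1%:R^-1.
  by rewrite gerBl.
elim: N => [|N IH]; first by rewrite big_geq// invr1 subrr.
rewrite big_nat_recr//= IH.
have n1 : N.+1%:R != 0 :> R by [].
have n2 : N.+2%:R != 0 :> R by [].
have E : N.+2%:R = N.+1%:R + 1 :> R by rewrite natr1.
rewrite E in n2 *; move: n1 n2; move: (N.+1%:R : R) => t n1 n2; field.
by rewrite n1 n2.
Qed.

(* At lam = 1 / (2 a sqrt k) the exponential moments are bounded, so [sum_k X k] is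
   integrable; a finite sum bounds each of its terms, hence |partial_sum k| / sqrt k
   by a multiple of log k. *)
Let X (k : nat) (w : S) : R :=
  let lam := (2 * a * Num.sqrt k.+1%:R)^-1 in
  (k.+1%:R * k.+2%:R)^-1 *
  (expR (lam * partial_sum k.+1 w) + expR (- lam * partial_sum k.+1 w)).

Lemma martingale_growth : {ae Pr, forall w, exists L, forall m : nat, (0 < m)%N ->
  `|partial_sum m w| <= 2 * a * Num.sqrt m%:R * (2 * ln m.+1%:R + L)}.
Proof.
have wk k : 0 < (k.+1%:R * k.+2%:R)^-1 :> R by rewrite invr_gt0 mulr_gt0.
have X0 k w : 0 < X k w by rewrite mulr_gt0// addr_gt0// expR_gt0.
have mX k : measurable_fun setT (X k).
  by apply: measurable_funM => //; exact: measurable_funD.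
pose Sum w := (\sum_(0 <= k <oo) (X k w)%:E)%E.
have EX k : (\int[Pr]_w (X k w)%:E <=
    ((k.+1%:R * k.+2%:R)^-1 * (2 * expR (2^-1)))%:E)%E.
  set lam := (2 * a * Num.sqrt k.+1%:R)^-1.
  have sk : 0 < Num.sqrt k.+1%:R :> R by rewrite sqrtr_gt0.
  have lam0 : 0 < lam by rewrite invr_gt0 !mulr_gt0.
  have lama : lam * a <= 2^-1.
    have s1 : 1 <= Num.sqrt k.+1%:R :> R by rewrite -[leLHS]sqrtr1 ler_sqrt// ler1n.
    rewrite mulrC ler_pdivrMr; last by rewrite !mulr_gt0.
    by rewrite -mulrA mulKf// ler_peMr// ltW.
  have b : 2 * (lam * a) ^+ 2 * k.+1%:R = 2^-1.
    rewrite -(@sqr_sqrtr _ k.+1%:R)// /lam.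
    move: sk; move: (Num.sqrt _) => s sk; field.
    by rewrite !gt_eqF.
  have H1 := @exp_moment_bound lam k.+1.
  have H2 := @exp_moment_bound (- lam) k.+1.
  rewrite normrN mulNr sqrrN in H2.
  rewrite (gtr0_norm lam0) b in H1 H2.
  have iX : Pr.-integrable setT (EFin \o X k).
    apply: (@integrable_bounded _ _ _ _ Pr1 _ ((k.+1%:R * k.+2%:R)^-1 *
      (expR (`|lam| * (a * k.+1%:R)) + expR (`|lam| * (a * k.+1%:R))))) => // w.
    rewrite normrM (gtr0_norm (wk k)) ler_wpM2l ?(ltW (wk k))//.
    by rewrite (le_trans (ler_normD _ _))// lerD// -(normrN lam).
  rewrite -[leLHS]fineK; last exact: integrable_fin_num.
  rewrite lee_fin -/(Rintegral _ _ _) RintegralZl//; last first.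
    apply: (@integrable_bounded _ _ _ _ Pr1 _
      (expR (`|lam| * (a * k.+1%:R)) + expR (`|lam| * (a * k.+1%:R)))) => [|w].
      exact: measurable_funD.
    by rewrite (le_trans (ler_normD _ _))// lerD// -(normrN lam).
  rewrite ler_pM2l// RintegralD// [leRHS]mulr_natl [leRHS]mulr2n lerD//; [exact: H1|exact: H2].
have Sum0 w : (0 <= Sum w)%E.
  by apply: nneseries_ge0 => k _ _; rewrite lee_fin ltW.
have mSum : measurable_fun setT Sum.
  apply: ge0_emeasurable_sum => [k w _ _|k _]; first by rewrite lee_fin ltW.
  exact/measurable_EFinP.
have ISum : Pr.-integrable setT Sum.
  apply/integrableP; split => //.
  under eq_integral do rewrite gee0_abs//.
  rewrite integral_nneseries//; last 2 first.
  - by move=> k; exact/measurable_EFinP.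
  - by move=> k w _; rewrite lee_fin ltW.
  apply: (@le_lt_trans _ _ (2 * expR (2^-1))%:E); last exact: ltry.
  apply: lime_le.
    by apply: is_cvg_nneseries => k _ _; apply: integral_ge0 => w _; rewrite lee_fin ltW.
  apply: nearW => N; rewrite (le_trans (lee_sum _ (fun k _ => EX k)))//.
  by rewrite sumEFin lee_fin -mulr_suml ler_piMl// telescoping_weights.
have := integrable_ae measurableT ISum.
apply: filterS => w /(_ I) Sumw.
have XS k : X k w <= fine (Sum w).
  rewrite -lee_fin fineK//.
  apply: (@le_trans _ _ (\sum_(0 <= i < k.+1) (X i w)%:E)%E).
    rewrite big_nat_recr//= leeDr// sume_ge0// => i _.
    by rewrite lee_fin ltW.
  by apply: nneseries_lim_ge => i _ _; rewrite lee_fin ltW.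
have S0 : 0 < fine (Sum w) by exact: lt_le_trans (XS 0%N).
exists (ln (fine (Sum w))) => -[//|k] _.
set s := Num.sqrt k.+1%:R.
have s0 : 0 < s by rewrite sqrtr_gt0.
have sa0 : 0 < 2 * a * s by rewrite !mulr_gt0.
rewrite -ler_pdivrMl// -[X in X * `|_|]gtr0_norm ?invr_gt0// -normrM.
set y := _ * partial_sum _ _.
(* Removing the weight of the single term [X k w] costs at most (k+2)^2. Taking logarithms with m =
   k+1 gives the [2 * ln m.+1%:R] of the statement, and [L] is the logarithm of the sum. *)
have ey : expR `|y| <= fine (Sum w) * k.+2%:R ^+ 2.
  have e1 : expR `|y| <= expR y + expR (- y).
    have [y0|y0] := leP 0 y; first by rewrite ger0_norm// lerDl expR_ge0.
    by rewrite ltr0_norm// lerDr expR_ge0.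
  apply: (le_trans e1).
  have : X k w * (k.+1%:R * k.+2%:R) = expR y + expR (- y).
    by rewrite /X mulrAC mulVf ?mul1r ?mulf_neq0// /y mulNr.
  move=> <-; apply: ler_pM; [by rewrite ltW|by rewrite mulr_ge0|exact: XS|].
  by rewrite expr2 ler_wpM2r// ler_nat.
by rewrite -ler_expR (le_trans ey)// expRD expRM_natl !lnK ?posrE// mulrC.
Qed.

End bounded_martingale.

(** * Epochs and rates *)

Section growth.
Context {R : realType}.

Lemma cvg_powR_neg (r : R) : r < 0 ->
  (fun m : nat => m%:R `^ r) @ \oo --> (0 : R).
Proof.
move=> r0; apply/cvgr0Pnorm_le => e e0.
near=> m; have m0 : 0 < m%:R :> R.
  by rewrite ltr0n; near: m; exact: nbhs_infty_gt.
rewrite ger0_norm ?powR_ge0//.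
pose q := - r; have q0 : 0 < q by rewrite oppr_gt0.
have me : e^-1 `^ q^-1 <= m%:R by near: m; exact: nbhs_infty_ger.
rewrite -(opprK r) -/q powRN -[leRHS]invrK lef_pV2 ?posrE ?invr_gt0 ?powR_gt0//.
have -> : e^-1 = (e^-1 `^ q^-1) `^ q.
  by rewrite -powRrM mulVf ?gt_eqF// powRr1// invr_ge0 ltW.
by apply: ge0_ler_powR => //; rewrite ?nnegrE ?powR_ge0// ltW.
Unshelve. all: by end_near. Qed.

Lemma scaled_average_cvg (x : nat -> R) (A rho kappa : R) : kappa + rho < 1 ->
  (forall m, (0 < m)%N -> `|x m| <= A * m%:R `^ rho) ->
  (fun m : nat => m%:R `^ kappa * (m%:R^-1 * x m)) @ \oo --> (0 : R).
Proof.
move=> kr xA.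
have lim : (fun m : nat => A * m%:R `^ (kappa + rho - 1)) @ \oo --> (0 : R).
  by rewrite -(mulr0 A); apply: cvgMr; apply: cvg_powR_neg; rewrite subr_lt0.
have bnd : \forall m \near \oo,
    `|m%:R `^ kappa * (m%:R^-1 * x m)| <= A * m%:R `^ (kappa + rho - 1).
  near=> m; have m0 : (0 < m)%N by near: m; exact: nbhs_infty_gt.
  have mR : 0 < m%:R :> R by rewrite ltr0n.
  rewrite !normrM (ger0_norm (powR_ge0 _ _)) ger0_norm ?invr_ge0//.
  have mn : m%:R != 0 :> R by rewrite gt_eqF.
  rewrite !powRD ?mn ?implybT// powR_inv1 ?ler0n//.
  rewrite [leRHS](_ : _ = m%:R `^ kappa * (m%:R^-1 * (A * m%:R `^ rho))); last by ring.
  by rewrite ler_wpM2l ?powR_ge0// ler_wpM2l ?invr_ge0// xA.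
apply: (@squeeze_cvgr _ _ _ _ (fun m => - (A * m%:R `^ (kappa + rho - 1)))
  (fun m => A * m%:R `^ (kappa + rho - 1))) => //.
  by near=> m; rewrite -ler_norml; near: m.
by rewrite -oppr0; exact: cvgN.
Unshelve. all: by end_near. Qed.

(** Apply ln y < y to y = (m+1)^delta; the factor 2^delta comes from m + 1 <= 2m. *)
Lemma ln_le_powR (delta : R) (m : nat) : 0 < delta -> (0 < m)%N ->
  ln m.+1%:R <= 2 `^ delta / delta * m%:R `^ delta.
Proof.
move=> d0 m0; have mR : 0 < m.+1%:R :> R by [].
have h : ln (m.+1%:R `^ delta) < m.+1%:R `^ delta :> R.
  by rewrite ln_sublinear// powR_gt0.
rewrite mulrAC ler_pdivlMr// mulrC -ln_powR (le_trans (ltW h))//.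
rewrite -powRM// ge0_ler_powR ?nnegrE//; first exact: ltW.
by rewrite -natrM ler_nat mul2n -addnn -addn1 leq_add2l.
Qed.

End growth.

Section epochs.
Context {R : realType}.
Variables (n : nat -> nat) (C beta : R).
Hypotheses (C_ge1 : 1 <= C) (beta_gt0 : 0 < beta)
  (lags : forall k : nat, (1 <= k)%N ->
     C^-1 * k%:R `^ beta <= (n k)%:R <= C * k%:R `^ beta).

Let C_gt0 : 0 < C. Proof. exact: lt_le_trans C_ge1. Qed.

Local Notation N := (update_time n).

Lemma update_timeS k : N k.+1 = (N k + n k.+1)%N.
Proof. by rewrite /update_time big_nat_recr. Qed.

Lemma update_time_lt k : (N k < N k.+1)%N.
Proof.
rewrite update_timeS -[ltnLHS]addn0 ltn_add2l -(ltr0n R).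
have /andP[+ _] := @lags k.+1 isT; apply: lt_le_trans.
by rewrite mulr_gt0 ?invr_gt0// powR_gt0.
Qed.

(** Keep the lags of index at least k/2: there are at least k/2 of them, each at least (k/2)^beta /
    C. *)
Lemma update_time_ge k : (k%:R / 2) `^ (1 + beta) <= C * (N k)%:R.
Proof.
have b1 : 0 < 1 + beta by rewrite addr_gt0.
case: k => [|k]; first by rewrite mul0r powR0 ?gt_eqF// mulr_ge0// ltW.
set h : R := k.+1%:R / 2; have h0 : 0 < h by rewrite divr_gt0.
have uk : (uphalf k.+1 <= k.+2)%N by rewrite -(leq_pmul2l (ltn0Sn 1)); lia.
rewrite /update_time (@big_cat_nat _ _ _ (uphalf k.+1))//.
rewrite natrD mulrDr.
apply: (@le_trans _ _ (C * (\sum_(uphalf k.+1 <= i < k.+2) n i)%:R)); last first.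
  by rewrite lerDr mulr_ge0// ltW.
rewrite natr_sum -ler_pdivrMl//.
apply: (@le_trans _ _ (\sum_(uphalf k.+1 <= i < k.+2) C^-1 * h `^ beta)); last first.
  rewrite !big_nat; apply: ler_sum => i /andP[ki _].
  have i0 : (0 < i)%N by rewrite (leq_trans _ ki).
  have /andP[+ _] := lags i0; apply: le_trans.
  rewrite ler_wpM2l ?invr_ge0 ?(ltW C_gt0)//.
  apply: ge0_ler_powR; rewrite ?nnegrE ?(ltW beta_gt0) ?(ltW h0)//.
  rewrite /h ler_pdivrMr// -natrM ler_nat; lia.
rewrite sumr_const_nat -mulr_natr -mulrA ler_wpM2l ?invr_ge0 ?(ltW C_gt0)//.
rewrite powRD; last by rewrite (gt_eqF h0) implybT.
rewrite (powRr1 (ltW h0)) mulrC ler_wpM2l ?powR_ge0// /h ler_pdivrMr// -natrM ler_nat; lia.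
Qed.

(** The number of updates made by time [m]. Adding at most one per time step is enough because all
    lags are positive, so update times are strictly increasing. *)
Fixpoint epoch (m : nat) : nat :=
  if m is m'.+1 then
    (if m'.+1 == N (epoch m').+1 then (epoch m').+1 else epoch m')
  else 0.

Lemma epochP m : (N (epoch m) <= m < N (epoch m).+1)%N.
Proof.
elim: m => [|m /andP[IH1 IH2]].
  have N0 : N 0 = 0%N by rewrite /update_time big_geq.
  by have := update_time_lt 0; rewrite /= N0.
rewrite [epoch _]/=; case: eqP => [{1 2}->|/eqP mN].
  by rewrite leqnn update_time_lt.
by rewrite (leq_trans IH1)//= ltn_neqAle mN.
Qed.

(** Invert [update_time_ge] at the last update time, which is at most [m]. *)
Lemma epoch_le m : (epoch m)%:R <= 2 * (C * m%:R) `^ (1 + beta)^-1.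
Proof.
have b1 : 0 < 1 + beta by rewrite addr_gt0.
have /andP[Nm _] := epochP m.
have h : ((epoch m)%:R / 2) `^ (1 + beta) <= C * m%:R.
  by rewrite (le_trans (update_time_ge _))// ler_wpM2l ?ler_nat// ltW.
rewrite mulrC -ler_pdivrMr//.
have e0 : 0 <= (epoch m)%:R / 2 :> R by rewrite divr_ge0.
have -> : (epoch m)%:R / 2 = (((epoch m)%:R / 2) `^ (1 + beta)) `^ (1 + beta)^-1 :> R.
  by rewrite -powRrM mulfV ?gt_eqF// powRr1.
apply: ge0_ler_powR => //; rewrite ?nnegrE ?powR_ge0 ?invr_ge0 ?(ltW b1)//.
by rewrite mulr_ge0// ltW.
Qed.

(** Subtracting the current end value makes the left side constant within an epoch. When the epoch
    changes, [g] is re-evaluated at the same time with the new index, which costs at most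
    [B + B]. *)
Lemma telescope_epochs (g : nat -> nat -> R) (B : R) :
  (forall k m, `|g k m| <= B) ->
  forall m, `|\sum_(0 <= i < m) (g (epoch i) i.+1 - g (epoch i) i) - g (epoch m) m|
    <= B * (1 + 2 * (epoch m)%:R).
Proof.
move=> gB; elim=> [|m IH].
  by rewrite big_geq// sub0r normrN mulr0 addr0 mulr1.
rewrite big_nat_recr// (_ : _ + _ - _ =
    \sum_(0 <= i < m) (g (epoch i) i.+1 - g (epoch i) i) - g (epoch m) m +
    (g (epoch m) m.+1 - g (epoch m.+1) m.+1)); last by ring.
rewrite (le_trans (ler_normD _ _))//=.
case: ifP => _; last by rewrite subrr normr0 addr0.
rewrite (_ : B * _ = B * (1 + 2 * (epoch m)%:R) + (B + B)).
  by rewrite lerD// (le_trans (ler_normB _ _))// lerD.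
by rewrite -[(epoch m).+1%:R]natr1; ring.
Qed.

End epochs.

(** * The AIR segment chain *)

Section AIR_martingale.
Context {R : realType} {d dO dS dG : measure_display} {chi : measurableType d}
  {Omega : measurableType dO} {G : measurableType dG} {S : measurableType dS}.
Variables (c : clock R) (ev : R -> Omega -> chi)
  (P : R -> R.-pker (G * chi) ~> chi) (Q : R.-pker (G * chi) ~> Omega)
  (pi_ : G -> probability chi R) (eps : R) (nu : probability chi R)
  (dnu deta : G -> chi -> chi -> R).
Hypotheses (T_gt0 : 0 < horizon c) (evP : is_path_space c ev)
  (stat : forall g, stationary c (fun t x => P t (g, x)) (pi_ g))
  (QP : forall g, is_path_law c ev (fun t x => P t (g, x)) (fun x => Q (g, x)))
  (eps01 : 0 < eps < 1)
  (minor : forall g x A, measurable A ->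
     (eps%:E * nu A <= P (horizon c) (g, x) A)%E)
  (mdnu : measurable_fun setT (fun z : G * chi * chi => dnu z.1.1 z.1.2 z.2))
  (mdeta : measurable_fun setT (fun z : G * chi * chi => deta z.1.1 z.1.2 z.2))
  (dnuP : forall g x, is_density nu (P (horizon c) (g, x)) (dnu g x))
  (detaP : forall g x, is_density (eta (P (horizon c) (g, x)) eps nu)
     (P (horizon c) (g, x)) (deta g x)).
Variables (n : nat -> nat) (C beta : R).
Hypotheses (C_ge1 : 1 <= C) (beta_gt0 : 0 < beta)
  (lags : forall k : nat, (1 <= k)%N ->
     C^-1 * k%:R `^ beta <= (n k)%:R <= C * k%:R `^ beta).
Variables (f : chi -> R) (M : R).
Hypotheses (mf : measurable_fun setT f) (fM : forall x, `|f x| <= M)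
  (f_centred : forall g, (\int[pi_ g]_x (f x)%:E = 0)%E).
Variables (Pr : probability S R) (Phi : nat -> S -> Omega) (Y : nat -> S -> bool)
  (gam : nat -> S -> G).
Hypotheses (mPhi : forall m, measurable_fun setT (Phi m))
  (mY : forall m, measurable_fun setT (Y m))
  (mgam : forall k, measurable_fun setT (gam k))
  (step : forall k m, (update_time n k <= m < update_time n k.+1)%N ->
    cond_law Pr (past Phi Y gam m k) (fun w => (Phi m.+1 w, Y m.+1 w))
      (fun w => split_kernel c ev eps (fun x => Q (gam k w, x)) (dnu (gam k w))
         (deta (gam k w)) (Phi m w, Y m w))).

Let e := ev (horizon c).
Let F := segment_mean c ev f.
Let ep := epoch n.

Let mF : measurable_fun setT F.
Proof. exact: (measurable_segment_mean T_gt0 evP mf fM). Qed.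

Let FM phi : `|F phi| <= M. Proof. exact: (segment_mean_le T_gt0 evP mf fM). Qed.

Let me : measurable_fun setT e.
Proof. by apply: (measurable_ev evP); rewrite lexx ltW. Qed.

Let Qe z A : measurable A -> Q z (e @^-1` A) = P (horizon c) z A.
Proof. exact: path_law_end. Qed.

Let M_ge0 : 0 <= M. Proof. exact: le_trans (normr_ge0 _) (fM point). Qed.

(** The Poisson equation is solved for all parameters at once, measurably in the parameter, because
    the random [gam k] is substituted later. *)
Lemma AIR_corrector : exists (g' : G * chi * bool -> R) (B : R),
  [/\ measurable_fun setT g', forall z, 0 <= g' z <= B &
      forall z b, split_step Q e eps dnu deta z b
        (fun p => (F p.1 + M + g' ((z.1, e p.1), p.2))%:E) =
        (g' (z, b) + M)%:E].
Proof.
pose h (z : G * chi) := \int[Q z]_phi F phi.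
have mh : measurable_fun setT h.
  apply: (@measurable_Rintegral_kernel _ _ _ _ _ Q (fun z => F z.2) M) => //.
  exact: measurableT_comp.
have hM z : `|h z| <= M.
  by apply: Rintegral_bounded => //; exact: prob_kernel.
have hT : times c (horizon c).
  by move: T_gt0; rewrite /times /horizon; case: c => [T /ltW|T _] //; exists T.
have [u [mu uM uP]] := @poisson_solution _ _ _ _ _ (P (horizon c)) nu eps pi_ h M
  eps01 (fun z A => let: (g, x) := z in minor g x (A := A))
  (fun g A => @stat g _ A hT) mh hM
  (segment_mean_centred T_gt0 evP QP stat mf fM f_centred).
have [g' [mg' g'B g'P]] := split_poisson_solution me Qe eps01 mdnu mdeta dnuP
  detaP mF FM mu uM uP.
by exists g', (M + M / eps + (M + M / eps)).
Qed.

Section increments.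
Variables (g' : G * chi * bool -> R) (B : R).
Hypotheses (mg' : measurable_fun setT g') (g'B : forall z, 0 <= g' z <= B)
  (g'P : forall z b, split_step Q e eps dnu deta z b
        (fun p => (F p.1 + M + g' ((z.1, e p.1), p.2))%:E) =
        (g' (z, b) + M)%:E).

(** Parameter index and time are separate: both ends of a step must be evaluated at the parameter
    driving it, even when the step ends at an update time. *)
Definition corrected (k m : nat) (w : S) : R :=
  g' ((gam k w, e (Phi m w)), Y m w).

(** The move from [m] to [m.+1] is made by the kernel with parameter index [ep m], while the F that
    it averages is that of the new segment. *)
Definition increment (m : nat) (w : S) : R :=
  F (Phi m.+1 w) + (corrected (ep m) m.+1 w - corrected (ep m) m w).

Let B_ge0 : 0 <= B. Proof. by case/andP: (g'B point) => x0; exact: le_trans. Qed.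

Lemma increment_le m w : `|increment m w| <= M + B.
Proof.
rewrite (le_trans (ler_normD _ _))// lerD//.
have /andP[? ?] := g'B ((gam (ep m) w, e (Phi m.+1 w)), Y m.+1 w).
have /andP[? ?] := g'B ((gam (ep m) w, e (Phi m w)), Y m w).
by rewrite /corrected ler_norml; apply/andP; split; lra.
Qed.

Let measurable_corrected d0 (W : measurableType d0) (a : W -> G) (b : W -> Omega * bool) :
  measurable_fun setT a -> measurable_fun setT b ->
  measurable_fun setT (fun w => g' ((a w, e (b w).1), (b w).2)).
Proof.
move=> ma mb; apply: (measurableT_comp mg'); apply: measurable_fun_pair => /=.
  apply: measurable_fun_pair => //; apply: measurableT_comp => //.
  exact: (measurableT_comp measurable_fst mb).
exact: (measurableT_comp measurable_snd mb).
Qed.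

Lemma measurable_increment m : measurable_fun setT (increment m).
Proof.
apply: measurable_funD; first exact: measurableT_comp.
apply: measurable_funB.
- by apply: (measurable_corrected (b := fun w => (Phi m.+1 w, Y m.+1 w))) => //;
    exact: measurable_fun_pair.
- by apply: (measurable_corrected (b := fun w => (Phi m w, Y m w))) => //;
    exact: measurable_fun_pair.
Qed.

(** The generators of [past], named so that the sigma-algebra they generate can serve as a
    measurable type. *)
Let past_gen m k : set (set S) :=
  [set H | exists i B, [/\ (i <= m)%N, measurable B &
                           H = (fun w => (Phi i w, Y i w)) @^-1` B]] `|`
  [set H | exists j B, [/\ (j <= k)%N, measurable B & H = gam j @^-1` B]].

Let past_sub m k : <<s past_gen m k >> `<=` @measurable _ S.
Proof.
apply: smallest_sub; first exact: sigma_algebra_measurable.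
move=> _ [[i [A [_ mA ->]]]|[j [A [_ mA ->]]]].
- rewrite -[X in measurable X]setTI; apply: (_ : measurable_fun setT _) => //.
  exact: measurable_fun_pair.
- by rewrite -[X in measurable X]setTI; exact: mgam.
Qed.

Let measurable_state m k i : (i <= m)%N ->
  measurable_fun (setT : set (g_sigma_algebraType (past_gen m k)))
    (fun w => (Phi i w, Y i w)).
Proof.
move=> im _ A mA; rewrite setTI; apply: sub_sigma_algebra.
by left; exists i, A.
Qed.

Let measurable_parameter m k j : (j <= k)%N ->
  measurable_fun (setT : set (g_sigma_algebraType (past_gen m k))) (gam j).
Proof.
move=> jk _ A mA; rewrite setTI; apply: sub_sigma_algebra.
by right; exists j, A.
Qed.

Let ep_mono i m : (i <= m)%N -> (ep i <= ep m)%N.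
Proof.
elim: m => [|m IH]; first by rewrite leqn0 => /eqP ->.
rewrite leq_eqVlt => /predU1P[->//|/IH/leq_trans]; apply.
by rewrite /ep /=; case: ifP.
Qed.

(** The last increment of the sum ends at state [m], and its parameter index is at most [ep m]; the
    sum is therefore known when the step out of [m] is conditioned. *)
Let measurable_partial_sum m :
  measurable_fun (setT : set (g_sigma_algebraType (past_gen m (ep m))))
    (partial_sum increment m).
Proof.
rewrite /partial_sum; under eq_fun do rewrite big_mkord.
apply: measurable_sum => i; have im := ltn_ord i.
have ms j : (j <= m)%N -> measurable_fun
    (setT : set (g_sigma_algebraType (past_gen m (ep m)))) (fun w => (Phi j w, Y j w)).
  exact: measurable_state.
have mp := @measurable_parameter m _ _ (ep_mono (ltnW im)).
apply: measurable_funD.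
  exact: (measurableT_comp (measurableT_comp mF measurable_fst) (ms _ im)).
apply: measurable_funB.
- exact: (measurable_corrected mp (ms _ im)).
- exact: (measurable_corrected mp (ms _ (ltnW im))).
Qed.

(** [cond_law_integral] with [J] the exponential weight times F + M + g' at the next state replaces
    the next state by [split_step], and [g'P] evaluates that to g' + M at the present one. The shift
    [M] cancels in the difference. *)
Lemma increment_orthogonal m lam :
  \int[Pr]_w (expR (lam * partial_sum increment m w) * increment m w) = 0.
Proof.
pose W (w : S) := expR (lam * partial_sum increment m w).
have mW : measurable_fun (setT : set (g_sigma_algebraType (past_gen m (ep m)))) W.
  by apply: measurableT_comp => //; apply: measurable_funM => //.
have mW' : measurable_fun (setT : set S) W.
  exact: (measurable_fun_coarser (@past_sub m (ep m)) mW).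
have W0 w : 0 <= W w by exact: expR_ge0.
have Pr1 : Pr setT = 1%E by exact: probability_setT.
have WB w : `|W w| <= expR (`|lam| * ((M + B) * m%:R)).
  rewrite ger0_norm// ler_expR (le_trans (ler_norm _))// normrM ler_wpM2l//.
  rewrite /partial_sum (le_trans (ler_norm_sum _ _ _))//.
  rewrite (le_trans (ler_sum _ (fun i _ => increment_le i w)))//.
  by rewrite sumr_const_nat subn0 mulr_natr.
pose J (z : g_sigma_algebraType (past_gen m (ep m)) * (Omega * bool)) :=
  (W z.1 * (F z.2.1 + M + g' ((gam (ep m) z.1, e z.2.1), z.2.2)))%:E.
have J0 z : (0 <= J z)%E.
  rewrite lee_fin mulr_ge0// addr_ge0//; last by case/andP: (g'B (gam (ep m) z.1, e z.2.1, z.2.2)).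
  by have := FM z.2.1; rewrite ler_norml; lra.
have mJ : measurable_fun setT J.
  apply/measurable_EFinP; apply: measurable_funM; first exact: (measurableT_comp mW measurable_fst).
  apply: measurable_funD.
    apply: measurable_funD => //.
    exact: (measurableT_comp (measurableT_comp mF measurable_fst) measurable_snd).
  exact: (measurable_corrected
    (measurableT_comp (@measurable_parameter m _ _ (leqnn _)) measurable_fst)
    measurable_snd).
pose K (w : S) := split_step Q e eps dnu deta (gam (ep m) w, e (Phi m w)) (Y m w).
have KP w : ge0_functional (K w) by exact: (split_step_functional Q me eps01 dnuP detaP).
have tower := @cond_law_integral _ _ _ _ _ Pr _ (@past_sub m (ep m))
  (fun w => (Phi m.+1 w, Y m.+1 w)) K (measurable_fun_pair (mPhi _) (mY _)) KP.
have {}tower : (\int[Pr]_w J (w, (Phi m.+1 w, Y m.+1 w)) =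
    \int[Pr]_w K w (fun z => J (w, z)))%E.
  apply: tower => //.
  - by move=> w; exact: (split_step1 me Qe eps01 dnuP detaP).
  - move=> J' J'0 mJ'.
    have mx : measurable_fun (setT : set (g_sigma_algebraType (past_gen m (ep m))))
        (fun w => (gam (ep m) w, e (Phi m w))).
      apply: measurable_fun_pair; first exact: measurable_parameter.
      exact: (measurableT_comp (measurableT_comp me measurable_fst)
        (@measurable_state m (ep m) m (leqnn m))).
    exact: (measurable_split_step Q me eps01 mdnu mdeta dnuP detaP mx
      (measurableT_comp measurable_snd (@measurable_state m (ep m) m (leqnn m))) J'0 mJ').
  - have := step (epochP C_ge1 lags m).
    congr cond_law; apply/funext => w; apply/funext => A.
    exact: split_kernelE.
have KE w : K w (fun z => J (w, z)) = (W w * (corrected (ep m) m w + M))%:E.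
  rewrite EFinM -g'P -(gf_scale (KP w))//.
    move=> p; rewrite lee_fin addr_ge0//; last by case/andP: (g'B (gam (ep m) w, e p.1, p.2)).
    by have := FM p.1; rewrite ler_norml; lra.
  apply/measurable_EFinP; apply: measurable_funD.
    by apply: measurable_funD => //; exact: (measurableT_comp mF measurable_fst).
  exact: (@measurable_corrected _ (Omega * bool)%type (cst (gam (ep m) w)) idfun
    (measurable_cst _) (@measurable_id _ _ _)).
have mc i : measurable_fun setT (corrected (ep m) i).
  by apply: (measurable_corrected (b := fun w => (Phi i w, Y i w))) => //;
    exact: measurable_fun_pair.
pose a (w : S) := W w * (F (Phi m.+1 w) + M + corrected (ep m) m.+1 w).
pose b (w : S) := W w * (corrected (ep m) m w + M).
have ma : measurable_fun setT a.
  apply: measurable_funM => //; apply: measurable_funD => //.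
  by apply: measurable_funD => //; exact: measurableT_comp.
have mb : measurable_fun setT b.
  by apply: measurable_funM => //; apply: measurable_funD.
have cB k i w : 0 <= corrected k i w <= B by exact: g'B.
have ia : Pr.-integrable setT (EFin \o a).
  apply: (@integrable_bounded _ _ _ _ Pr1 _
    (expR (`|lam| * ((M + B) * m%:R)) * (M + M + B))) => // w.
  rewrite normrM ler_pM//.
  have := FM (Phi m.+1 w); have := cB (ep m) m.+1 w; rewrite !ler_norml; lra.
have ib : Pr.-integrable setT (EFin \o b).
  apply: (@integrable_bounded _ _ _ _ Pr1 _
    (expR (`|lam| * ((M + B) * m%:R)) * (B + M))) => // w.
  rewrite normrM ler_pM//.
  by have := cB (ep m) m w; rewrite ler_norml; move: M_ge0; lra.
transitivity (\int[Pr]_w (a w - b w)).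
  by apply: eq_Rintegral => w _; rewrite /a /b /increment -/(W w); ring.
rewrite RintegralB//; apply/eqP; rewrite subr_eq0; apply/eqP; congr fine.
by under [RHS]eq_integral do rewrite -KE.
Qed.

(** The increments start with F at [Phi 1], so the initial segment is split off and contributes a
    bounded term. *)
Lemma sum_segment_mean (m : nat) (w : S) :
  \sum_(0 <= i < m.+1) F (Phi i w) = F (Phi 0 w) + partial_sum increment m w -
    \sum_(0 <= i < m) (corrected (ep i) i.+1 w - corrected (ep i) i w).
Proof.
rewrite big_nat_recl// -addrA; congr (_ + _).
by rewrite /partial_sum -sumrB; apply: eq_bigr => i _; rewrite /increment addrK.
Qed.

End increments.

Lemma AIR_strong_law (kappa : R) : kappa < Num.min 2^-1 (beta / (1 + beta)) ->
  {ae Pr, forall w,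
    (fun m : nat => m%:R `^ kappa *
       (m%:R^-1 * \sum_(0 <= i < m) segment_mean c ev f (Phi i w)))
      @ \oo --> (0 : R)}.
Proof.
rewrite lt_min => /andP[kappa2 kappab].
have [g' [B [mg' g'B g'P]]] := AIR_corrector.
have B0 : 0 <= B by case/andP: (g'B point) => x0; exact: le_trans.
(* The 1 keeps [a] positive even when both bounds vanish. *)
pose a := M + B + 1.
have a0 : 0 < a by rewrite ltr_wpDl// addr_ge0.
have Da m w : `|increment g' m w| <= a.
  by rewrite (le_trans (increment_le g'B m w))// lerDl.
have := martingale_growth a0 (measurable_increment mg') Da
  (increment_orthogonal mg' g'B g'P).
apply: filterS => w [L LP].
pose p := (1 + beta)^-1.
have b1 : 0 < 1 + beta by rewrite addr_gt0.
have p0 : 0 < p by rewrite invr_gt0.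
have [delta d0 dk] : exists2 delta, 0 < delta & delta < 2^-1 - kappa.
  by exists ((2^-1 - kappa) / 2); lra.
(* [p] is the growth exponent of the number of epochs; [delta] absorbs the logarithm of the
   martingale bound. The two upper bounds on [kappa] are exactly what keeps [kappa + rho] below 1 in
   either case. *)
pose rho := Num.max p (2^-1 + delta).
have krho : kappa + rho < 1.
  rewrite /rho maxEle; case: ifP => _; first by lra.
  have : beta / (1 + beta) + p = 1 by rewrite /p -[X in _ + X]mul1r -mulrDl addrC divff// gt_eqF.
  by move: kappab; lra.
have rho0 : 0 <= rho by rewrite le_max ltW.
(* [c1] collects the initial segment and the two boundary terms of the telescoping. In [c2] one
   factor 2 is the two correctors exchanged at an update, the other comes from [epoch_le]; [c3] is
   the martingale. *)
pose c1 := M + B + B.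
pose c2 := 4 * B * C `^ p.
pose c3 := 2 * a * (2 * (2 `^ delta / delta) + `|L|).
have K0 : 0 <= 2 * (2 `^ delta / delta) + `|L|.
  by rewrite addr_ge0// mulr_ge0// divr_ge0 ?powR_ge0 ?(ltW d0).
have a20 : 0 <= 2 * a by rewrite mulr_ge0 ?(ltW a0).
have c30 : 0 <= c3 by exact: mulr_ge0.
apply: (@scaled_average_cvg _ _ (c1 + c2 + c3) rho _ krho) => -[//|m] _.
set t : R := m.+1%:R.
have t1 : 1 <= t by rewrite ler1n.
have t0 : 0 <= t by exact: le_trans t1.
have trho q : q <= rho -> t `^ q <= t `^ rho by exact: ler_powR.
rewrite (sum_segment_mean g') (le_trans (ler_normB _ _))//.
rewrite (le_trans (lerD (ler_normD _ _) (lexx _)))//.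
have h1 : c1 <= c1 * t `^ rho.
  rewrite ler_peMr ?addr_ge0//.
  by rewrite -[leLHS](powRr0 t); exact: trho.
have tele : `|\sum_(0 <= i < m) (corrected g' (ep i) i.+1 w - corrected g' (ep i) i w)|
    <= B + B + c2 * t `^ rho.
  have cB k i : `|corrected g' k i w| <= B.
    by have /andP[x0 xB] := g'B ((gam k w, e (Phi i w)), Y i w); rewrite ger0_norm.
  have := telescope_epochs n cB m.
  set s := \sum_(0 <= i < m) _ => hs.
  have : `|s| <= B * (1 + 2 * (epoch n m)%:R) + B.
    rewrite -[s](subrK (corrected g' (epoch n m) m w)).
    by rewrite (le_trans (ler_normD _ _))// lerD.
  move=> /le_trans; apply.
  have em := epoch_le C_ge1 beta_gt0 lags m.
  have : (epoch n m)%:R <= 2 * (C `^ p * t `^ rho).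
    apply: (le_trans em); rewrite ler_pM2l// powRM//; last exact: le_trans C_ge1.
    rewrite ler_wpM2l ?powR_ge0//.
    apply: (@le_trans _ _ (t `^ p)); last by apply: trho; rewrite le_max lexx.
    by apply: ge0_ler_powR; rewrite ?nnegrE ?(ltW p0) ?ler_nat.
  move=> hx; rewrite [leLHS](_ : _ = B + B + B * (2 * (epoch n m)%:R)); last by ring.
  rewrite lerD2l (_ : c2 * _ = B * (2 * (2 * (C `^ p * t `^ rho)))).
    by rewrite ler_wpM2l// ler_pM2l.
  by rewrite /c2; ring.
have mart : `|partial_sum (increment g') m w| <= c3 * t `^ rho.
  (* [martingale_growth] covers positive times only; at [m = 0] the partial sum is empty. *)
  case: m @t t1 t0 trho {tele h1} => [|m] t t1 t0 trho.
    by rewrite /partial_sum big_geq// normr0 (mulr_ge0 c30)// powR_ge0.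
  apply: (le_trans (LP m.+1 isT)).
  have sq : Num.sqrt m.+1%:R <= t `^ 2^-1 by rewrite powR12_sqrt// ler_sqrt// ler_nat.
  have ln1 : ln m.+2%:R <= 2 `^ delta / delta * t `^ delta.
    apply: (le_trans (ln_le_powR d0 (ltn0Sn m))); rewrite ler_wpM2l ?divr_ge0 ?powR_ge0 ?(ltW d0)//.
    by apply: ge0_ler_powR; rewrite ?nnegrE ?(ltW d0) ?ler_nat.
  have td : 1 <= t `^ delta by rewrite -[leLHS](powRr0 t) ler_powR// ltW.
  have lnL : 2 * ln m.+2%:R + L <= (2 * (2 `^ delta / delta) + `|L|) * t `^ delta.
    rewrite [leRHS]mulrDl lerD//; first by rewrite -mulrA ler_pM2l.
    by rewrite (le_trans (ler_norm _))// ler_peMr.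
  apply: (@le_trans _ _ (2 * a * t `^ 2^-1 * ((2 * (2 `^ delta / delta) + `|L|) * t `^ delta))).
    apply: (@le_trans _ _ (2 * a * Num.sqrt m.+1%:R * ((2 * (2 `^ delta / delta) + `|L|) * t `^ delta))).
      by rewrite ler_wpM2l// mulr_ge0// sqrtr_ge0.
    by apply: ler_wpM2r; [rewrite mulr_ge0 ?powR_ge0|rewrite ler_wpM2l].
  rewrite (_ : _ * _ = c3 * (t `^ 2^-1 * t `^ delta)); last by rewrite /c3; ring.
  rewrite (ler_wpM2l c30)//.
  rewrite -powRD; last by rewrite (gt_eqF (lt_le_trans ltr01 t1)) implybT.
  by apply: trho; rewrite le_max lexx orbT.
have := FM (Phi 0 w); move: h1 tele mart.
by rewrite /c1 !mulrDl; lra.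
Qed.

End AIR_martingale.

Theorem theorem4p6 (R : realType) (c : clock R)
  (d dO dS : measure_display)
  (chi : measurableType d) (Omega : measurableType dO) (G : pmetricType R)
  (ev : R -> Omega -> chi)
  (P : R -> R.-pker (Borel G * chi) ~> chi)
  (Q : R.-pker (Borel G * chi) ~> Omega)
  (pi_ : G -> probability chi R)
  (eps : R) (nu : probability chi R)
  (dnu deta : G -> chi -> chi -> R)
  (* the underlying processes and their segments *)
  (T_gt0 : 0 < horizon c)
  (Omega_paths : is_path_space c ev)
  (P_semigroup : forall g, markov_semigroup c (fun t x => P t (g, x)))
  (pi_stationary : forall g, stationary c (fun t x => P t (g, x)) (pi_ g))
  (Q_law : forall g,
     is_path_law c ev (fun t x => P t (g, x)) (fun x => Q (g, x)))
  (* simultaneous minorisation *)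
  (eps01 : 0 < eps < 1)
  (minorisation : forall g x A, measurable A ->
     (eps%:E * nu A <= P (horizon c) (g, x) A)%E)
  (* densities of nu and eta with respect to P^T *)
  (dnu_measurable : measurable_fun setT
     (fun z : Borel G * chi * chi => dnu z.1.1 z.1.2 z.2))
  (deta_measurable : measurable_fun setT
     (fun z : Borel G * chi * chi => deta z.1.1 z.1.2 z.2))
  (dnu_density : forall g x, is_density nu (P (horizon c) (g, x)) (dnu g x))
  (deta_density : forall g x,
     is_density (eta (P (horizon c) (g, x)) eps nu)
       (P (horizon c) (g, x)) (deta g x))
  (* adaptation lags *)
  (n : nat -> nat) (C beta : R) (C_ge1 : 1 <= C) (beta_gt0 : 0 < beta)
  (lags : forall k : nat, (1 <= k)%N ->
     C^-1 * k%:R `^ beta <= (n k)%:R <= C * k%:R `^ beta)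
  (* the test function *)
  (f : chi -> R) (f_measurable : measurable_fun setT f)
  (f_bounded : exists M : R, forall x, `|f x| <= M)
  (f_centred : forall g, (\int[pi_ g]_x (f x)%:E = 0)%E)
  (* the AIR segment chain *)
  (phi0 : Omega) (y0 : bool) (gam0 : G)
  (adapt : forall k : nat,
     R.-pker ((update_time n k.+1).-tuple Omega * k.+1.-tuple (Borel G))
       ~> Borel G)
  (S : measurableType dS) (Pr : probability S R)
  (Phi : nat -> S -> Omega) (Y : nat -> S -> bool) (gam : nat -> S -> Borel G)
  (chain : AIR_segment_chain Pr Phi Y gam
     (fun g => split_kernel c ev eps (fun x => Q (g, x)) (dnu g) (deta g))
     adapt phi0 y0 gam0)
  (kappa : R) (kappa_lt : kappa < Num.min 2^-1 (beta / (1 + beta))) :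
  {ae Pr, forall w,
    (fun m : nat => m%:R `^ kappa *
       (m%:R^-1 * \sum_(0 <= i < m) segment_mean c ev f (Phi i w)))
      @ \oo --> (0 : R)}.
Proof.
have [M fM] := f_bounded.
case: chain => mPhi mY mgam _ step _.
exact: (AIR_strong_law T_gt0 Omega_paths pi_stationary Q_law eps01 minorisation
  dnu_measurable deta_measurable dnu_density deta_density C_ge1 beta_gt0 lags
  f_measurable fM f_centred mPhi mY mgam step kappa_lt).
Qed.
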